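(* Let $X=\{0,1\}^{\mathbb{N}\cup\{0\}}$, let $T\colon X\to X$ be the left shift, and let $\mu$ be the $(1/2,1/2)$-Bernoulli measure on $X$. Let $(r_m)_{m\in\mathbb{N}}$ be a non-decreasing unbounded sequence of positive integers, and let $\mathcal{B}=\{B_1\supset B_2\supset\cdots\}$ with $$B_m=\{x\in X: x[0]=x[1]=\cdots=x[r_m-1]=0\},\qquad m\in\mathbb{N},$$ so that $\mu(B_m)=2^{-r_m}$. Assume that at least one of the following two conditions is satisfied: (i) there exists $D>2$ such that $\mu(B_m)\geq \frac{D\log\log m}{m}$ for all but finitely many $m\in\mathbb{N}$; (ii) there exists $\tau>1$ such that $\mu(B_m)\leq \frac{1}{(\log m)^{\tau}}$ for all but finitely many $m\in\mathbb{N}$. If $$\sum_{n=1}^\infty \frac{\big(1-\mu(B_{n})\big)^{\frac{n(1-\epsilon)}{2}}}{n}<\infty$$ for some $\epsilon>0$, then $\mathcal{H}_{\mathrm{e.a.}}(\mathcal{B})$ has full $\mu$-measure. On the other hand, if $$\sum_{n=1}^\infty\frac{\big(1-\mu(B_{n})\big)^{\frac{n}{2}}}{n}=\infty,$$ then $\mathcal{H}_{\mathrm{e.a.}}(\mathcal{B})$ has zero $\mu$-measure.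
   Context: $\mathbb{N}=\{1,2,3,\dots\}$. Points of $X$ are sequences $x=(x[0],x[1],x[2],\dots)$, and $(Tx)[i]=x[i+1]$. Put $O_m(x)=\{Tx,T^2x,\dots,T^mx\}$. The eventually always hitting set is $$\mathcal{H}_{\mathrm{e.a.}}(\mathcal{B})=\{x\in X: O_m(x)\cap B_m\neq\varnothing\text{ for all but finitely many }m\in\mathbb{N}\}.$$ *)

(* Defs.v *)
From HB Require Import structures.
From mathcomp Require Import all_boot all_order all_algebra.
From mathcomp Require Import zify.
From mathcomp Require Import all_classical all_reals all_analysis.
From mathcomp Require Import measurable_realfun.

Set Implicit Arguments.
Unset Strict Implicit.
Unset Printing Implicit Defensive.

Import Order.TTheory GRing.Theory Num.Theory.
Import numFieldNormedType.Exports.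

Local Open Scope classical_set_scope.
Local Open Scope ring_scope.

(* The product sigma-algebra on {0,1}^{nat}: it is generated by the preimages,
   under the coordinate maps, of the measurable subsets of bool.  The symbols
   0 and 1 are encoded as false and true. *)
Definition coordinate_events : set (set (nat -> bool)) :=
  \bigcup_i preimage_set_system setT (fun x : nat -> bool => x i) measurable.

Notation binseq := (g_sigma_algebraType coordinate_events).

Definition left_shift (x : binseq) : binseq := fun i => x i.+1.

(* The values of mu on the cylinders determine mu on the product
   sigma-algebra; existence is bernoulli_half_exists below. *)
Definition is_bernoulli_half (R : realType) (mu : probability binseq R) : Prop :=
  forall (n : nat) (w : nat -> bool),
    mu [set x : binseq | forall i, (i < n)%N -> x i = w i] = (2^-1 ^+ n)%:E.

Definition orbit_segment (X : Type) (T : X -> X) (m : nat) (x : X) : set X :=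
  [set iter k T x | k in [set k | (1 <= k <= m)%N]].

(* Neighbourhoods of \oo in nat are the cofinite sets; the value of B at 0 is
   irrelevant. *)
Definition ea_hitting (X : Type) (T : X -> X) (B : nat -> set X) : set X :=
  [set x | \forall m \near \oo, orbit_segment T m x `&` B m !=set0].

Definition zero_cylinder (k : nat) : set binseq :=
  [set x : binseq | forall i, (i < k)%N -> x i = false].

Section existence.
Context {R : realType}.

Definition digits (t : R) : binseq := fun i => odd (Num.truncn (2 ^+ i.+1 * t)).

Lemma truncn_double_half (s : R) : 0 <= s ->
  Num.truncn (2 * s) = (odd (Num.truncn (2 * s)) + (Num.truncn s).*2)%N.
Proof.
move=> s0; rewrite -[LHS]odd_double_half; congr (_ + _.*2)%N.
have s20 : 0 <= 2 * s by rewrite mulr_ge0.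
apply/esym/truncn_def; have /andP[h1 h2] := truncn_itv s20.
set k := Num.truncn (2 * s) in h1 h2 *.
apply/andP; split.
  rewrite -(@ler_pM2l _ 2)// -natrM; apply: le_trans h1.
  by rewrite ler_nat mul2n -[leqRHS](odd_double_half k) leq_addl.
rewrite -(@ltr_pM2l _ 2)// -natrM; apply: lt_le_trans h2 _.
by rewrite ler_nat mul2n doubleS -[in leqLHS](odd_double_half k) !ltnS -add1n leq_add2r; case: odd.
Qed.

Fixpoint code (w : nat -> bool) (n : nat) : nat :=
  if n is n'.+1 then (w n' + (code w n').*2)%N else 0%N.

Lemma code_lt w n : (code w n < 2 ^ n)%N.
Proof.
elim: n => //= n IH; rewrite expnS mul2n -addnn.
have : (w n <= 1)%N by case: (w n).
rewrite -addnn; move: (code w n) (2 ^ n)%N (nat_of_bool _) IH => a b c; lia.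
Qed.

Lemma digits_code (t : R) w n : 0 <= t < 1 ->
  (forall i, (i < n)%N -> digits t i = w i) <->
  Num.truncn (2 ^+ n * t) = code w n.
Proof.
move=> /andP[t0 t1]; elim: n => [|n IH].
  split=> // _; rewrite expr0 mul1r /=; apply: truncn_def.
  by rewrite t0 /= t1.
have s0 : 0 <= 2 ^+ n * t by rewrite mulr_ge0 ?exprn_ge0.
have E := truncn_double_half s0; rewrite mulrA -exprS in E.
split=> [H|H].
  rewrite E /= -/(digits t n) (H n)//; congr (_ + _.*2)%N; apply/IH => i ni.
  by apply: H; exact: ltnW.
move: (H); rewrite E /= -/(digits t n) => H'.
have Hd : digits t n = w n.
  by move/(congr1 odd): H'; rewrite !oddD !odd_double !addbF !oddb.
have Hw : forall i, (i < n)%N -> digits t i = w i.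
  by apply/IH; move: H'; rewrite Hd => /addnI /double_inj.
by move=> i; rewrite ltnS leq_eqVlt => /predU1P[->//|]; exact: Hw.
Qed.

Lemma measurable_digits : measurable_fun setT digits.
Proof.
have mlt (c : R) (k : nat) :
    measurable [set t : R | (Num.truncn (c * t) < k)%N].
  case: k => [|k]; first by rewrite (_ : mkset _ = set0)//; apply/seteqP; split.
  rewrite (_ : mkset _ = [set t | c * t < k.+1%:R]); last first.
    by apply/seteqP; split=> t /=; rewrite ltnS leqNgt truncn_gt_nat -ltNge.
  have mf : measurable_fun setT (fun t : R => c * t < k.+1%:R).
    by apply: measurable_fun_ltr => //; exact: measurable_funM.
  by have := mf measurableT [set true] Logic.I; rewrite setTI.
apply: (@measurability default_measure_display _ R binseq setT digits coordinate_events erefl) => _ [_ [i _ [B _ <-]] <-].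
rewrite !setTI.
have -> : digits @^-1` ((fun x : nat -> bool => x i) @^-1` B) =
    \bigcup_(k in [set k | B (odd k)])
      ([set t : R | (Num.truncn (2 ^+ i.+1 * t)%R < k.+1)%N] `\`
       [set t : R | (Num.truncn (2 ^+ i.+1 * t)%R < k)%N]).
  apply/seteqP; split=> t /=.
    move=> Bt; exists (Num.truncn (2 ^+ i.+1 * t)) => //=.
    by split=> //=; rewrite ltnn.
  move=> [k /= Bk []]; rewrite ltnS => h1 /negP; rewrite -leqNgt => h2.
  rewrite /preimage /= /digits (_ : Num.truncn _ = k)//.
  by apply/eqP; rewrite eqn_leq h1.
by apply: bigcup_measurable => k _; apply: measurableD; exact: mlt.
Qed.

Let digits_mfun : measurableTypeR R -> binseq := digits.

HB.instance Definition _ :=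
  isMeasurableFun.Build _ _ _ _ digits_mfun measurable_digits.

Let unit_prob : probability (measurableTypeR R) R :=
  mnormalize (mrestr (@lebesgue_measure R) (measurable_itv `[0, 1[))
    (uniform_prob (@ltr01 R)).

Lemma bernoulli_half_exists : exists mu : probability binseq R, is_bernoulli_half mu.
Proof.
exists (distribution unit_prob digits_mfun) => n w.
rewrite /distribution /pushforward /unit_prob /= /mnormalize /= /mrestr setTI.
rewrite lebesgue_measure_itv /= lte_fin ltr01 /= oppr0 adde0.
rewrite onee_eq0 /= addr0 invr1 mule1.
rewrite (_ : _ `&` _ = `[(code w n)%:R / 2 ^+ n, (code w n).+1%:R / 2 ^+ n[%classic).
  rewrite lebesgue_measure_itv /= lte_fin ltr_pM2r ?invr_gt0 ?exprn_gt0//.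
  rewrite ltr_nat ltnSn -EFinD -mulrBl -natrB// subSnn mul1r exprVn.
  reflexivity.
have p0 : 0 < 2 ^+ n :> R by rewrite exprn_gt0.
apply/seteqP; split=> t; rewrite /= !in_itv /=.
  move=> [Ht t01]; have := (digits_code w n t01).1 Ht.
  move/andP: t01 => [t0 t1] <-.
  rewrite ler_pdivrMr// ltr_pdivlMr// mulrC.
  by rewrite truncn_itv// mulr_ge0// ltW.
move=> /andP[]; rewrite ler_pdivrMr// ltr_pdivlMr// => h1 h2.
have t01 : 0 <= t < 1.
  apply/andP; split.
    by rewrite -(pmulr_lge0 _ p0); apply: le_trans h1.
  rewrite -(ltr_pM2r p0) mul1r; apply: lt_le_trans h2 _.
  by rewrite -natrX ler_nat code_lt.
split=> //; apply/(digits_code w n t01); apply: truncn_def.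
by rewrite mulrC h1 h2.
Qed.

End existence.

(* Main.v *)
(** Let f_r(m) be the probability that
    no run of r zeros starts at the positions 0, ..., m-1 of a random sequence and put
    y = 2^{-r-1}.  Conditioning on the first r+1 symbols gives
    f_r(m+2) = f_r(m+1) - y f_r(m+1-r), whence f_r(m) <= exp(-y m), and, up to a
    constant and an error O(1/m), exp(-y m) <= f_r(m).  The point x misses B_m when no
    run of length r_m starts in 1, ..., m; this event has probability f_{r_m}(m).

    Convergence: if x misses B_m, then for each n in [m, (1+1/q)m] no run of length
    r_n starts in 1, ..., nq/(q+1).  So the probability of missing B_m for some
    m >= M is at most a constant times the tail of sum_n f_{r_n}(nq/(q+1)) / n, which
    replaces the Borel-Cantelli lemma along geometric scales.

    Divergence: the second moment method applied to the weighted count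
    S = sum_n 1{miss B_n}/n over a long window far away, with the positions up to some N
    ignored, gives E[S^2] <= const E[S]^2, because
    f_{r_l}(l-j-r_j) <= const (exp(-y_l l) + j/l) for j <= l and
    sum_{l >= j} j/l^2 = O(1).  Hence, independently of the past, some miss occurs in
    the window with probability bounded below, and iterating over successive windows
    shows that almost surely infinitely many B_m are missed.

    Probabilities of events depending on finitely many symbols are computed with the
    transfer operator of the shift: its n-th iterate maps an observable of the first n
    symbols to its mean, and psi * (phi o T^n) to mean(psi) * phi. *)

Require Import Defs.
From mathcomp Require Import all_boot all_order all_algebra.
From mathcomp Require Import all_classical all_reals all_analysis.
From mathcomp Require Import zify ring lra.

Set Implicit Arguments.
Unset Strict Implicit.
Unset Printing Implicit Defensive.

Import Order.TTheory GRing.Theory Num.Theory.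
Import numFieldNormedType.Exports.

Local Open Scope classical_set_scope.
Local Open Scope ring_scope.

(** * The transfer operator of the shift and means of finitely determined observables *)

Definition push (b : bool) (x : nat -> bool) : nat -> bool :=
  fun i => if i is j.+1 then x j else b.

Definition shiftn (n : nat) (x : nat -> bool) : nat -> bool :=
  fun i => x (n + i)%N.

Definition determined (T : Type) (n : nat) (phi : (nat -> bool) -> T) :=
  forall x x', (forall i, (i < n)%N -> x i = x' i) -> phi x = phi x'.

Definition transfer (R : realType) (phi : (nat -> bool) -> R) : (nat -> bool) -> R :=
  fun x => (phi (push false x) + phi (push true x)) / 2.

(** The base point is arbitrary: when [phi] reads only the first [n] symbols, its [n]-th iterate is
    constant. *)
Definition mean (R : realType) (n : nat) (phi : (nat -> bool) -> R) : R :=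
  iter n (@transfer R) phi (fun=> false).

Section transfer.
Context {R : realType}.
Implicit Types (phi psi : (nat -> bool) -> R) (x : nat -> bool).
Local Notation L := (@transfer R).

Lemma determinedW (T : Type) m n (phi : (nat -> bool) -> T) :
  (m <= n)%N -> determined m phi -> determined n phi.
Proof. by move=> mn D x x' H; apply: D => i im; apply/H/(leq_trans im). Qed.

Lemma determined_comp (T U : Type) n (g : T -> U) (phi : (nat -> bool) -> T) :
  determined n phi -> determined n (fun x => g (phi x)).
Proof. by move=> D x x' H; rewrite (D x x'). Qed.

Lemma determined_shiftn (T : Type) m n (phi : (nat -> bool) -> T) :
  determined n phi -> determined (m + n) (fun x => phi (shiftn m x)).
Proof.
by move=> D x x' H; apply: D => i im; apply: H; rewrite ltn_add2l.
Qed.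

Lemma determined_push (T : Type) b n (phi : (nat -> bool) -> T) :
  determined n.+1 phi -> determined n (fun x => phi (push b x)).
Proof. by move=> D x x' H; apply: D => -[|i]//=; rewrite ltnS; exact: H. Qed.

Lemma iter_transfer_linear n a phi psi x :
  iter n L (fun z => a * phi z + psi z) x
  = a * iter n L phi x + iter n L psi x.
Proof.
elim: n phi psi => [//|n IH] phi psi; rewrite !iterSr -IH.
by congr (iter n L _ x); apply/funext => z; rewrite /transfer; field.
Qed.

Lemma iter_transfer_cst n c x : iter n L (fun=> c) x = c.
Proof.
elim: n => [//|n IH]; rewrite iterSr -[RHS]IH.
by congr (iter n L _ x); apply/funext => z; rewrite /transfer; field.
Qed.

Lemma iter_transferZ n a phi x :
  iter n L (fun z => a * phi z) x = a * iter n L phi x.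
Proof.
rewrite -[RHS]addr0 -[X in _ + X](iter_transfer_cst n 0 x).
by rewrite -iter_transfer_linear; congr (iter n L _ x); apply/funext => z; rewrite addr0.
Qed.

Lemma iter_transferD n phi psi x :
  iter n L (fun z => phi z + psi z) x = iter n L phi x + iter n L psi x.
Proof.
rewrite -[X in X + _]mul1r -iter_transfer_linear.
by congr (iter n L _ x); apply/funext => z; rewrite mul1r.
Qed.

Lemma iter_transferB n phi psi x :
  iter n L (fun z => phi z - psi z) x = iter n L phi x - iter n L psi x.
Proof.
rewrite iter_transferD; congr (_ + _); rewrite -mulN1r -iter_transferZ.
by congr (iter n L _ x); apply/funext => z; rewrite mulN1r.
Qed.

Lemma iter_transfer_sum (I : Type) (s : seq I) n (phi : I -> (nat -> bool) -> R) x :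
  iter n L (fun z => \sum_(i <- s) phi i z) x
  = \sum_(i <- s) iter n L (phi i) x.
Proof.
elim: s => [|i s IH].
  rewrite big_nil -[RHS](iter_transfer_cst n 0 x).
  by congr (iter n L _ x); apply/funext => z; rewrite big_nil.
rewrite big_cons -IH -iter_transferD.
by congr (iter n L _ x); apply/funext => z; rewrite big_cons.
Qed.

Lemma le_iter_transfer n phi psi x :
  (forall z, phi z <= psi z) -> iter n L phi x <= iter n L psi x.
Proof.
elim: n phi psi => [|n IH] phi psi H; first exact: H.
by rewrite !iterSr; apply: IH => z; rewrite ler_pM2r ?invr_gt0// lerD.
Qed.

(** The [n]-th iterate at [x] averages over all prefixes of length [n] placed before [x]; [shiftn n]
    deletes the prefix, so the second factor is the constant [phi x]. *)
Lemma iter_transfer_mul_shiftn n phi psi x :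
  iter n L (fun z => psi z * phi (shiftn n z)) x = iter n L psi x * phi x.
Proof.
elim: n psi => [//|n IH] psi; rewrite !iterSr -IH.
congr (iter n L _ x); apply/funext => z; rewrite /transfer.
rewrite -[shiftn n.+1 (push false z)]/(shiftn n z).
by rewrite -[shiftn n.+1 (push true z)]/(shiftn n z); field.
Qed.

Lemma iter_transfer_shiftn n phi x :
  iter n L (fun z => phi (shiftn n z)) x = phi x.
Proof.
rewrite -[RHS]mul1r -[in RHS](iter_transfer_cst n 1 x) -iter_transfer_mul_shiftn.
by congr (iter n L _ x); apply/funext => z; rewrite mul1r.
Qed.

Lemma iter_transfer_determined n phi x :
  determined n phi -> iter n L phi x = mean n phi.
Proof.
rewrite /mean; elim: n phi => [|n IH] phi D; first exact: D.
rewrite !iterSr; apply: IH => z z' H; rewrite /transfer.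
by congr ((_ + _) / 2); apply: D => -[|i]//= /H.
Qed.

(** The first [n] iterations already produce a constant. Observables that read different numbers of
    symbols can thus be compared at one common level [k]. *)
Lemma iter_transfer_level n k phi x :
  determined n phi -> (n <= k)%N -> iter k L phi x = mean n phi.
Proof.
move=> D nk; rewrite -(subnK nk) iterD -[RHS](iter_transfer_cst (k - n) _ x).
by congr (iter _ L _ x); apply/funext => z; exact: iter_transfer_determined.
Qed.

Lemma iter_transfer_independent n m phi psi x : determined n psi ->
  iter (m + n) L (fun z => psi z * phi (shiftn n z)) x
  = mean n psi * iter m L phi x.
Proof.
move=> D; rewrite iterD -iter_transferZ; congr (iter m L _ x).
by apply/funext => z; rewrite iter_transfer_mul_shiftn iter_transfer_determined.
Qed.

End transfer.

(** * Zero runs and sequences that avoid them *)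

Definition zrun (r k : nat) (x : nat -> bool) : bool :=
  [forall i : 'I_r, ~~ x (k + i)%N].

Definition avoid (r m : nat) (x : nat -> bool) : bool :=
  [forall k : 'I_m, ~~ zrun r k x].

Implicit Type x : nat -> bool.

Lemma zrunP r k x : reflect (forall i, (i < r)%N -> x (k + i)%N = false) (zrun r k x).
Proof.
apply: (iffP forallP) => [H i ir|H i]; last by rewrite H.
by apply/negbTE; exact: (H (Ordinal ir)).
Qed.

Lemma avoidP r m x :
  reflect (forall k, (k < m)%N -> exists2 i, (i < r)%N & x (k + i)%N) (avoid r m x).
Proof.
apply: (iffP forallP) => [H k km|H k].
  have := H (Ordinal km); rewrite negb_forall => /existsP[i]; rewrite negbK => xi.
  by exists i.
by have [i ir xi] := H k (ltn_ord k); rewrite negb_forall; apply/existsP; exists (Ordinal ir); rewrite negbK.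
Qed.

Lemma avoidPn r m x :
  reflect (exists2 k, (k < m)%N & zrun r k x) (~~ avoid r m x).
Proof.
rewrite negb_forall; apply: (iffP existsP) => [[k]|[k km zk]].
  by rewrite negbK => zk; exists k.
by exists (Ordinal km); rewrite negbK.
Qed.

Lemma zrun_shiftn r k n x : zrun r k (shiftn n x) = zrun r (n + k) x.
Proof. by apply: eq_forallb => i; rewrite /shiftn addnA. Qed.

Lemma avoidW r r' m m' x : (r <= r')%N -> (m' <= m)%N -> avoid r m x -> avoid r' m' x.
Proof.
move=> rr mm /avoidP H; apply/avoidP => k km.
have [i ir xi] := H k (leq_trans km mm).
by exists i => //; exact: leq_trans rr.
Qed.

Lemma avoid_shiftn r m n x : avoid r m x -> avoid r (m - n) (shiftn n x).
Proof.
move=> /avoidP H; apply/avoidP => k km.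
have [|i ir xi] := H (n + k)%N; first lia.
by exists i => //; rewrite /shiftn addnA.
Qed.

Lemma determined_zrun r k : determined (k + r) (zrun r k).
Proof. by move=> x x' H; apply: eq_forallb => i; rewrite H// ltn_add2l. Qed.

Lemma determined_avoid r m : determined (m + r) (avoid r m).
Proof.
move=> x x' H; apply: eq_forallb => k; congr (~~ _).
apply: determined_zrun => i ik; apply: H.
by apply: (leq_trans ik); rewrite leq_add2r ltnW.
Qed.

Lemma avoidS r m x : avoid r m.+1 x = ~~ zrun r 0 x && avoid r m (shiftn 1 x).
Proof.
apply/forallP/andP => [H|[z0 /forallP H] [[|k] km]] //.
  split; first exact: (H ord0).
  by apply/forallP => k; rewrite zrun_shiftn; exact: (H (lift ord0 k)).
by have := H (Ordinal (km : (k < m)%N)); rewrite zrun_shiftn.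
Qed.

(* After an initial zero run, the start [1] is avoided only if the run stops
   at [r], and then the starts [1, ..., r] are avoided as well. *)
Lemma avoid_zrun r m x : zrun r 0 x ->
  avoid r m.+1 (shiftn 1 x) = x r && avoid r (m.+1 - r) (shiftn r.+1 x).
Proof.
move=> /zrunP z0; apply/avoidP/andP => [H|[xr /avoidP H] k km].
  split.
    have [i ir] := H 0 (ltn0Sn m).
    rewrite /shiftn => xi; have [ri|ri] := ltnP i.+1 r.
      by move: xi; rewrite add0n add1n -[i.+1]add0n z0.
    by have -> : r = (1 + (0 + i))%N by lia.
  apply/avoidP => k km; have [|i ir xi] := H (r + k)%N; first lia.
  exists i => //; move: xi; rewrite /shiftn.
  by have -> : (1 + (r + k + i) = r.+1 + (k + i))%N by lia.
(* For [k < r] the window of length [r] starting at [k + 1] contains position [r], where a one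
   stands. *)
have [kr|rk] := ltnP k r.
  exists (r - k.+1)%N; first lia.
  by rewrite /shiftn; have -> : (1 + (k + (r - k.+1)) = r)%N by lia.
have [|i ir xi] := H (k - r)%N; first lia.
exists i => //; move: xi; rewrite /shiftn.
by have -> : (r.+1 + (k - r + i) = 1 + (k + i))%N by lia.
Qed.

(** * The avoidance probability and its recursion *)

Definition avoid_prob (R : realType) (r m : nat) : R :=
  mean (m + r) (fun x => (avoid r m x)%:R).

Section avoid_prob.
Context {R : realType}.
Local Notation f := (@avoid_prob R).
Local Notation L := (@transfer R).

Lemma avoid_prob_level r m k x : (m + r <= k)%N ->
  iter k L (fun z => (avoid r m z)%:R) x = f r m.
Proof.
move=> mk; apply: iter_transfer_level => //.
exact/(determined_comp (fun b : bool => b%:R))/determined_avoid.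
Qed.

Lemma iter_transfer_zrun r x : iter r L (fun z => (zrun r 0 z)%:R) x = 2^-1 ^+ r.
Proof.
elim: r => [|r IH] /=.
  by rewrite (_ : zrun 0 0 x)//; apply/zrunP.
rewrite -iterS iterSr exprS -IH -iter_transferZ.
congr (iter r L _ x); apply/funext => z; rewrite /transfer.
rewrite (_ : zrun r.+1 0 (push true z) = false); last first.
  by apply/negP => /zrunP /(_ 0 isT).
rewrite (_ : zrun r.+1 0 (push false z) = zrun r 0 z); last first.
  by apply/zrunP/zrunP => [H i ir|H [|i] ir]; rewrite ?add0n//; [exact: (H i.+1)|exact: (H i)].
by rewrite addr0 mulrC.
Qed.

Lemma avoid_prob0 r : f r 0 = 1.
Proof.
rewrite /avoid_prob -[RHS](iter_transfer_cst (0 + r) 1 (fun=> false)).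
congr (iter _ L _ _); apply/funext => z; rewrite (_ : avoid r 0 z)//.
by apply/avoidP.
Qed.

Lemma avoid_prob1 r : f r 1 = 1 - 2^-1 ^+ r.
Proof.
rewrite -(@avoid_prob_level r 1 (1 + r) (fun=> false))//.
rewrite -(iter_transfer_zrun r (fun=> false)).
have D : determined r (fun z => (zrun r 0 z)%:R : R).
  exact/(determined_comp (fun b : bool => b%:R))/(@determined_zrun r 0).
rewrite (iter_transfer_level _ D)// -(iter_transfer_level (fun=> false) D (leq_addl 1 r)).
rewrite -[X in X - _](iter_transfer_cst (1 + r) 1 (fun=> false)) -iter_transferB.
congr (iter _ L _ _); apply/funext => z; rewrite avoidS (_ : avoid r 0 _); last exact/avoidP.
by case: zrun; rewrite /= ?subrr ?subr0.
Qed.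

(** Avoiding the starts [1, ..., m + 1] fails to imply avoiding [0] as well only on the event
    described by [avoid_zrun]: [r] zeros, a one, then [m + 1 - r] free starts. The truncated
    difference is 0 for short ranges, giving the factor 1. The recursion begins at [m.+2] because
    with no start beyond 0 the one at position [r] is not forced. *)
Lemma avoid_prob_rec r m :
  f r m.+2 = f r m.+1 - 2^-1 ^+ r.+1 * f r (m.+1 - r).
Proof.
(* A level high enough that, after stripping one symbol or [r + 1] symbols, the remaining observable
   is still determined. *)
set K := (m.+1 + r)%N; pose x0 : nat -> bool := fun=> false.
rewrite -(@avoid_prob_level r m.+2 (K.+1 + r) x0); last by rewrite /K; lia.
rewrite (_ : (fun z => _) = (fun z => (avoid r m.+1 (shiftn 1 z))%:R -
   (zrun r 0 z && z r)%:R * (avoid r (m.+1 - r) (shiftn r.+1 z))%:R)); last first.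
  apply/funext => z; rewrite avoidS; case: (boolP (zrun r 0 z)) => [z0|_] /=.
    by rewrite avoid_zrun//; case: (z r); rewrite ?(mul1r, mul0r) subrr.
  by rewrite mul0r subr0.
rewrite iter_transferB; congr (_ - _).
  rewrite -[RHS](@avoid_prob_level r m.+1 (K + r) x0); last by rewrite /K; lia.
  rewrite (_ : (K.+1 + r = K + r + 1)%N); last lia.
  by rewrite iterD; congr (iter _ L _ _); apply/funext => z; exact: (iter_transfer_shiftn 1 (fun z => (avoid r m.+1 z)%:R)).
rewrite (_ : (K.+1 + r = K + r.+1)%N); last lia.
rewrite -[f _ (_ - _)](@avoid_prob_level r _ K x0); last by rewrite /K; lia.
rewrite iterD -iter_transferZ; congr (iter _ L _ _); apply/funext => z.
rewrite (iter_transfer_mul_shiftn r.+1 (fun z => (avoid r (m.+1 - r) z)%:R)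
   (fun z => (zrun r 0 z && z r)%:R)); congr (_ * _).
(* The first [r] iterations average out the zeros and leave the symbol [z r] in front; the last one
   contributes the factor 1/2 of the required one. *)
rewrite iterS (_ : iter r L _ = fun w => 2^-1 ^+ r * (w 0)%:R); last first.
  apply/funext => w; rewrite -(iter_transfer_zrun r w).
  rewrite -(iter_transfer_mul_shiftn r (fun z => (z 0)%:R)).
  congr (iter _ L _ _); apply/funext => v; rewrite /shiftn addn0.
  by case: zrun; rewrite ?mul1r ?mul0r.
by rewrite /transfer /= mulr0 add0r mulr1 exprSr.
Qed.

Lemma avoid_prob_ge0 r m : 0 <= f r m.
Proof.
rewrite -(iter_transfer_cst (m + r) 0 (fun=> false)).
by apply: le_iter_transfer => z; exact: ler0n.
Qed.

Lemma le_avoid_prob r r' m m' : (r <= r')%N -> (m' <= m)%N -> f r m <= f r' m'.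
Proof.
move=> rr mm; pose x0 : nat -> bool := fun=> false.
rewrite -(@avoid_prob_level r m (m + r') x0) ?leq_add2l//.
rewrite -(@avoid_prob_level r' m' (m + r') x0) ?leq_add2r//.
apply: le_iter_transfer => z; rewrite ler_nat.
by have := @avoidW r r' m m' z rr mm; case: (avoid r m z) => // ->.
Qed.

End avoid_prob.

(** * Exponential upper and lower bounds for the avoidance probability *)

Section avoid_prob_bounds.
Context {R : realType}.
Local Notation f := (@avoid_prob R).

Lemma half_pow_gt0 n : 0 < 2^-1 ^+ n :> R.
Proof. by rewrite exprn_gt0. Qed.

Lemma avoid_prob_le1 r m : f r m <= 1.
Proof. by rewrite -(@avoid_prob0 R r); exact: le_avoid_prob. Qed.

Lemma avoid_probS_le r m : f r m.+1 <= (1 - 2^-1 ^+ r.+1) * f r m.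
Proof.
have y0 := half_pow_gt0 r.+1.
case: m => [|m].
  have := half_pow_gt0 r; rewrite avoid_prob1 avoid_prob0 exprS; lra.
rewrite avoid_prob_rec mulrBl mul1r lerB// ler_pM2l//.
by apply: le_avoid_prob => //; exact: leq_subr.
Qed.

Lemma avoid_prob_le_expR r m : f r m <= expR (- (m%:R * 2^-1 ^+ r.+1)).
Proof.
elim: m => [|m IH]; first by rewrite avoid_prob0 mul0r oppr0 expR0.
apply: le_trans (avoid_probS_le r m) _.
rewrite (_ : - (m.+1%:R * _) = - 2^-1 ^+ r.+1 - m%:R * 2^-1 ^+ r.+1); last first.
  by rewrite -natr1; ring.
rewrite expRD; apply: ler_pM => //.
- by rewrite subr_ge0 exprn_ile1// invf_le1// ler1n.
- exact: avoid_prob_ge0.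
- exact: expR_ge1Dx.
Qed.

Lemma bernoulli_ineq (a : R) n : 0 <= a <= 1 -> 1 - n%:R * a <= (1 - a) ^+ n.
Proof.
move=> /andP[a0 a1]; elim: n => [|n IH]; first by rewrite mul0r subr0.
have n0 : 0 <= n%:R :> R by [].
rewrite exprS -natr1; apply: le_trans (_ : (1 - a) * (1 - n%:R * a) <= _); first by nra.
by apply: ler_wpM2l => //; lra.
Qed.

(** For [z <= 1/2] one has [1 / (1 - z) <= 1 + z + 2 z^2], which is at most the exponential of
    [z + 2 z^2]. *)
Lemma expR_le_1B (z : R) : 0 <= z <= 2^-1 -> expR (- (z + 2 * z ^+ 2)) <= 1 - z.
Proof.
move=> z01; rewrite expRN invf_ple ?posrE ?expR_gt0//; last lra.
apply: le_trans (expR_ge1Dx _); rewrite invf_ple ?posrE; [|lra|by nra].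
by rewrite -[X in X <= _]mul1r ler_pdivrMr; nra.
Qed.

(** The threshold 4, which recurs in the lower bounds below, is the least one for which this
    holds. *)
Lemma leq_4M_exp2 r : (4 <= r -> 4 * r.+2 <= 2 ^ r.+1)%N.
Proof.
elim: r => // r IH; rewrite leq_eqVlt => /predU1P[<-//|/IH].
by rewrite (expnS 2 r.+1); lia.
Qed.

Lemma half_pow_mul_le r : (4 <= r)%N -> r.+2%:R * 2^-1 ^+ r.+1 <= 4^-1 :> R.
Proof.
move=> r4; rewrite exprVn ler_pdivrMr ?exprn_gt0// ler_pdivlMl//.
by rewrite -natrX -natrM ler_nat leq_4M_exp2.
Qed.

(** Strong induction on [m]: if the earlier ratios are at least [s], going back [r] steps costs at
    most [s^-r], which is bounded by [1 + 4 w]. The recursion then loses at most the factor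
    [1 - y (1 + 4 w) = s]. *)
Lemma avoid_prob_ratio r (y w s : R) :
  (4 <= r)%N -> y = 2^-1 ^+ r.+1 -> w = r.+2%:R * y -> s = 1 - y * (1 + 4 * w) ->
  forall m, s * f r m.+1 <= f r m.+2.
Proof.
move=> r4 yE wE sE.
have y0 : 0 < y by rewrite yE.
have w4 : w <= 4^-1 by rewrite wE yE half_pow_mul_le.
have r4R : 4 <= r%:R :> R by rewrite (ler_nat R 4).
have rE : r.+2%:R = r%:R + 2 :> R by rewrite -addn2 natrD.
have w0 : 6 * y <= w by rewrite wE rE; apply: ler_wpM2r; lra.
have s01 : 0 <= s <= 1 by rewrite sE; nra.
(* The factor [1 - 2 y] is the first ratio [f r 1 / f r 0], which the induction does not cover; it
   enters when going back [r] steps reaches 0. *)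
have key : 1 <= (1 + 4 * w) * (s ^+ r * (1 - 2 * y)).
  have H : 1 - r%:R * (y * (1 + 4 * w)) <= s ^+ r.
    by rewrite sE; apply: bernoulli_ineq; nra.
  have H2 : 1 - w * (1 + 4 * w) <= s ^+ r * (1 - 2 * y).
    apply: le_trans (_ : (1 - r%:R * (y * (1 + 4 * w))) * (1 - 2 * y) <= _).
      pose q := r%:R * y; have q0 : 0 <= q by rewrite mulr_ge0 // ltW.
      rewrite mulrA -/q (_ : w * _ = (q + 2 * y) * (1 + 4 * w)); last first.
        by rewrite {1}wE rE mulrDl.
      have : 0 <= q * y by rewrite mulr_ge0// ltW.
      have : 0 <= q * y * w by rewrite !mulr_ge0// ltW//; lra.
      have : 0 <= y * w by rewrite mulr_ge0//; lra.
      lra.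
    by apply: ler_wpM2r => //; lra.
  apply: le_trans (_ : (1 + 4 * w) * (1 - w * (1 + 4 * w)) <= _); first nra.
  by apply: ler_wpM2l => //; lra.
elim/ltn_ind => m IH.
have chain j : (j <= m)%N -> s ^+ j * f r (m.+1 - j) <= f r m.+1.
  elim: j => [|j IHj] jm; first by rewrite expr0 mul1r subn0.
  apply: le_trans (IHj (ltnW jm)).
  rewrite exprSr -mulrA ler_wpM2l ?exprn_ge0//; first lra.
  have -> : (m.+1 - j = (m - j.+1).+2)%N by lia.
  have -> : (m.+1 - j.+1 = (m - j.+1).+1)%N by lia.
  by apply: IH; lia.
have Hr : f r (m.+1 - r) <= (1 + 4 * w) * f r m.+1.
  have sr0 : 0 <= s ^+ r by rewrite exprn_ge0//; lra.
  have [rm|mr] := leqP r m.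
    apply: le_trans (_ : (1 + 4 * w) * (s ^+ r * f r (m.+1 - r)) <= _); last first.
      by apply: ler_wpM2l; [lra|exact: chain].
    have f0 := @avoid_prob_ge0 R r (m.+1 - r).
    rewrite mulrA ler_peMl//; apply: le_trans key _.
    rewrite mulrA ler_piMr//; last lra.
    by rewrite mulr_ge0//; lra.
  rewrite (_ : (m.+1 - r = 0)%N) ?avoid_prob0; last lia.
  apply: le_trans key _; apply: ler_wpM2l; first lra.
  apply: le_trans (chain m (leqnn m)).
  rewrite subSn// subnn avoid_prob1 (_ : 2^-1 ^+ r = 2 * y); last by rewrite yE exprS; field.
  apply: ler_wpM2r; first lra.
  by apply: ler_wiXn2l; [lra|lra|exact: ltnW].
rewrite avoid_prob_rec -yE sE mulrBl mul1r lerB// -mulrA.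
by apply: ler_wpM2l => //; exact: ltW.
Qed.

(** The ratio bound gives geometric decay at rate [z = y + 4 w y], and the hypothesis says
    [n w y <= 1], so the correction to the exponent stays bounded. The 6 comes from
    [z + 2 z^2 <= y + 6 w y], and the 2 absorbs the initial factor [1 - 2 y >= 1/2]. *)
Lemma avoid_prob_ge_expR r n : (4 <= r)%N ->
  n%:R * (r.+2%:R * (2^-1 ^+ r.+1) ^+ 2) <= 1 :> R ->
  expR (- (n%:R * 2^-1 ^+ r.+1)) <= 2 * expR 6 * f r n.
Proof.
move=> r4; set y : R := 2^-1 ^+ r.+1 => H.
pose w := r.+2%:R * y; pose z := y * (1 + 4 * w).
have y0 : 0 < y by rewrite /y.
have w4 : w <= 4^-1 by rewrite /w half_pow_mul_le.
have r4R : 4 <= r%:R :> R by rewrite (ler_nat R 4).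
have w0 : 6 * y <= w.
  by rewrite /w -addn2 natrD; apply: ler_wpM2r; lra.
have z0 : 0 <= z <= 2 * y by rewrite /z; nra.
have step : (1 - 2 * y) * (1 - z) ^+ n <= f r n.
  have z1 : 0 <= (1 - z) by lra.
  case: n {H} => [|n]; first by rewrite avoid_prob0 expr0; lra.
  elim: n => [|n IH].
    rewrite avoid_prob1 (_ : 2^-1 ^+ r = 2 * y); last by rewrite /y exprS; field.
    by rewrite expr1; nra.
  apply: le_trans (avoid_prob_ratio r4 erefl erefl erefl n).
  by rewrite exprS mulrCA; apply: ler_wpM2l IH.
have zexp : expR (- (n%:R * (z + 2 * z ^+ 2))) <= (1 - z) ^+ n.
  rewrite -mulrN expRM_natl; apply: lerXn2r; rewrite ?nnegrE ?expR_ge0//; first lra.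
  by apply: expR_le_1B; lra.
have le6 : n%:R * (z + 2 * z ^+ 2) <= n%:R * y + 6.
  have n0 : 0 <= n%:R :> R by [].
  have H' : n%:R * (w * y) <= 1 by rewrite /w -mulrA -expr2.
  have : z + 2 * z ^+ 2 <= y + 6 * (w * y).
    have : z ^+ 2 <= w * y by nra.
    by rewrite /z; nra.
  by move=> /(ler_wpM2l n0); rewrite mulrDr; lra.
apply: le_trans (_ : 2 * expR 6 * ((1 - 2 * y) * (1 - z) ^+ n) <= _); last first.
  by apply: ler_wpM2l => //; rewrite mulr_ge0 ?expR_ge0.
apply: le_trans (_ : expR 6 * expR (- (n%:R * (z + 2 * z ^+ 2))) <= _).
  by rewrite -expRD ler_expR; lra.
rewrite -[leRHS]mulrA [leRHS]mulrCA ler_wpM2l ?expR_ge0//; apply: le_trans zexp _.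
rewrite mulrA ler_peMl ?exprn_ge0//; lra.
Qed.

Lemma expR_ge_cube (t : R) : 0 <= t -> t ^+ 3 <= 27 * expR t.
Proof.
move=> t0; have -> : t = 3%:R * (t / 3) by field.
rewrite expRM_natl exprMn; have -> : 3%:R ^+ 3 = 27 :> R by ring.
rewrite ler_wpM2l//; apply: lerXn2r; rewrite ?nnegrE ?expR_ge0//; first lra.
by apply: le_trans (expR_ge1Dx _); lra.
Qed.

Lemma leq_sqr_exp2 s : (4 <= s -> s ^ 2 <= 2 ^ s)%N.
Proof.
elim: s => // s IH; rewrite leq_eqVlt => /predU1P[<-//|s4].
have := IH s4; rewrite (expnS 2 s); nia.
Qed.

(** This is the complementary regime. Squaring the hypothesis and using [(r + 2)^2 y <= 2] yields
    [n <= 2 (n y)^3], and the exponential of [n y] dominates [(n y)^3 / 27]. *)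
Lemma expR_le_inv r n : (4 <= r)%N -> (0 < n)%N ->
  1 < n%:R * (r.+2%:R * (2^-1 ^+ r.+1) ^+ 2) :> R ->
  expR (- (n%:R * 2^-1 ^+ r.+1)) <= 54 / n%:R :> R.
Proof.
move=> r4 n0; set y : R := 2^-1 ^+ r.+1 => H.
set s : R := r.+2%:R in H.
have nR : 0 < n%:R :> R by rewrite ltr0n.
have y0 : 0 < y by rewrite /y.
have s0 : 0 < s by rewrite /s.
have sy : s ^+ 2 * y <= 2.
  rewrite /y exprVn ler_pdivrMr ?exprn_gt0// -exprS /s -!natrX ler_nat.
  by apply: leq_sqr_exp2; lia.
have n2 : 1 < (n%:R * (s * y ^+ 2)) ^+ 2 by rewrite exprn_egt1.
have key : n%:R <= 2 * (n%:R * y) ^+ 3.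
  have -> : (n%:R * y) ^+ 3 = n%:R * (n%:R ^+ 2 * y ^+ 3) by ring.
  have : 1 <= 2 * (n%:R ^+ 2 * y ^+ 3); last by nra.
  apply: le_trans (ltW n2) _.
  have -> : (n%:R * (s * y ^+ 2)) ^+ 2 = (s ^+ 2 * y) * (n%:R ^+ 2 * y ^+ 3) by ring.
  by apply: ler_wpM2r => //; rewrite mulr_ge0// exprn_ge0// ltW.
have := @expR_ge_cube (n%:R * y) (mulr_ge0 (ltW nR) (ltW y0)) => cube.
rewrite expRN ler_pdivlMr// mulrC ler_pdivrMr ?expR_gt0//; lra.
Qed.

Lemma expR_le_avoid_prob r n : (4 <= r)%N -> (0 < n)%N ->
  expR (- (n%:R * 2^-1 ^+ r.+1)) <= 2 * expR 6 * f r n + 54 / n%:R.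
Proof.
move=> r4 n0; have [H|H] := leP (n%:R * (r.+2%:R * (2^-1 ^+ r.+1) ^+ 2)) (1 : R).
  apply: le_trans (avoid_prob_ge_expR r4 H) _.
  by rewrite lerDl divr_ge0.
apply: le_trans (expR_le_inv r4 n0 H) _.
by rewrite lerDr mulr_ge0 ?avoid_prob_ge0// mulr_ge0// expR_ge0.
Qed.

End avoid_prob_bounds.

(** * The Bernoulli measure of finitely determined events *)

Section bernoulli_mean.
Context {R : realType} (mu : probability binseq R).
Hypothesis mu_half : is_bernoulli_half mu.

Lemma measurable_cylinder n (w : nat -> bool) :
  measurable [set x : binseq | forall i, (i < n)%N -> x i = w i].
Proof.
elim: n => [|n IH].
  by rewrite (_ : mkset _ = setT)//; apply/seteqP; split.
rewrite (_ : mkset _ = [set x : binseq | forall i, (i < n)%N -> x i = w i] `&`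
                       [set x : binseq | x n = w n]).
  apply: measurableI => //; apply: sub_sigma_algebra; exists n => //.
  by exists [set w n] => //; rewrite setTI.
apply/seteqP; split=> [x H|x [H1 H2] i].
  by split=> [i ni|]; apply: H => //; exact: ltnW.
by rewrite ltnS leq_eqVlt => /predU1P[->//|]; exact: H1.
Qed.

(** The prescribed prefix makes the induction go through: each step splits on the symbol at position
    [k] and moves it from the argument of [A] into the prefix, until [A] is constant and a cylinder
    or the empty set remains. *)
Lemma cylinder_mean n (A : (nat -> bool) -> bool) k (w : nat -> bool) :
  determined n A ->
  let S := [set x : binseq | (forall i, (i < k)%N -> x i = w i) /\ A (shiftn k x)] in
  measurable S /\ mu S = (2^-1 ^+ k * mean n (fun x => (A x)%:R))%:E.
Proof.
elim: n A k w => [|n IH] A k w D /=.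
  have AE z : A z = A (fun=> false) by apply: D => i; rewrite ltn0.
  rewrite /mean /=; case: (boolP (A (fun=> false))) AE => _ AE.
    rewrite (_ : mkset _ = [set x : binseq | forall i, (i < k)%N -> x i = w i]).
      by rewrite mulr1; split; [exact: measurable_cylinder|exact: mu_half].
    by apply/seteqP; split=> x /=; [case|split=> //; rewrite AE].
  rewrite (_ : mkset _ = set0); last by apply/seteqP; split=> x //= []; rewrite AE.
  by rewrite mulr0 measure0.
pose wb b i := if i == k then b else w i.
pose Sb b := [set x : binseq | (forall i, (i < k.+1)%N -> x i = wb b i) /\
                A (push b (shiftn k.+1 x))].
have IHb b := IH (fun x => A (push b x)) k.+1 (wb b) (determined_push b D).
have SE : [set x : binseq | (forall i, (i < k)%N -> x i = w i) /\ A (shiftn k x)]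
          = Sb false `|` Sb true.
  have pushE (x : nat -> bool) : shiftn k x = push (x k) (shiftn k.+1 x).
    by apply/funext => -[|i] /=; rewrite /shiftn ?addn0 ?addnS.
  apply/seteqP; split=> x.
    move=> [H Ax]; suff : Sb (x k) x by case: (x k) => ?; [right|left].
    split; last by rewrite -pushE.
    by move=> i; rewrite /wb ltnS leq_eqVlt; case: (eqVneq i k) => [->//|_] /=; exact: H.
  have aux b : Sb b x -> (forall i, (i < k)%N -> x i = w i) /\ A (shiftn k x).
    move=> [H Ax]; have xk : x k = b by rewrite H// /wb eqxx.
    split; last by rewrite pushE xk.
    by move=> i ik; rewrite H ?(leqW ik)// /wb ltn_eqF.
  by move=> [/aux|/aux].
rewrite SE; split; first by apply: measurableU; [exact: (IHb false).1|exact: (IHb true).1].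
rewrite measureU; [|exact: (IHb false).1|exact: (IHb true).1|]; last first.
  rewrite -subset0 => x [[H1 _] [H2 _]].
  by have := H1 k (ltnSn k); rewrite H2// /wb eqxx.
rewrite [X in (X + _)%E](IHb false).2 [X in (_ + X)%E](IHb true).2 -EFinD.
rewrite /mean iterSr (_ : transfer _ = (fun x => 2^-1 * (A (push false x))%:R +
   2^-1 * (A (push true x))%:R)); last by apply/funext => x; rewrite /transfer; field.
by rewrite iter_transferD !iter_transferZ exprS; congr _%:E; field.
Qed.

Lemma determined_measurable n (A : (nat -> bool) -> bool) : determined n A ->
  measurable [set x : binseq | A x].
Proof.
move=> D; have [+ _] := cylinder_mean 0 (fun=> false) D.
by congr measurable; apply/seteqP; split=> x /= => [[]|].
Qed.

Lemma determined_measure n (A : (nat -> bool) -> bool) : determined n A ->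
  mu [set x : binseq | A x] = (mean n (fun x => (A x)%:R))%:E.
Proof.
move=> D; have [_] := cylinder_mean 0 (fun=> false) D.
rewrite expr0 mul1r => <-.
by congr (mu _); apply/seteqP; split=> x /= => [|[]].
Qed.

End bernoulli_mean.

(** * The second moment method on one window *)

Section second_moment.
Context {R : realType}.
Local Notation f := (@avoid_prob R).
Local Notation L := (@transfer R).

(** The coefficients of [avoid_prob_gap_le] after summing over [l >= j] with weights [1/l]: the
    bound [2 / j] on the sum of [1/l^2] doubles [54] and [2]. *)
Definition moment_cst : R := 2 * expR 8 + 108 * expR 2 + 4 * expR 1.

Lemma moment_cst_gt0 : 0 < moment_cst.
Proof. by rewrite /moment_cst !addr_gt0// mulr_gt0// expR_gt0. Qed.

Lemma sum_inv_sqr j n : (0 < j)%N ->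
  \sum_(j <= l < n) (l%:R ^+ 2)^-1 <= 2 / j%:R :> R.
Proof.
move=> j0; suff : \sum_(j <= l < n) (l%:R ^+ 2)^-1 <= \sum_(j <= l < n) (- (2 / l.+1%:R) - - (2 / l%:R)) :> R.
  move/le_trans; apply; have [jn|nj] := leqP j n; last first.
    by rewrite big_geq ?divr_ge0// ltnW.
  rewrite (telescope_sumr (fun l => - (2 / l%:R)))//.
  by rewrite opprK gerDr oppr_le0 divr_ge0.
rewrite big_seq [leRHS]big_seq; apply: ler_sum => l; rewrite mem_index_iota => /andP[jl _].
have l0 : 1 <= l%:R :> R by rewrite ler1n (leq_trans j0).
rewrite -natr1; set a := l%:R in l0 *.
rewrite (_ : - _ - _ = 2 / (a * (a + 1))); last by field; apply/andP; split; lra.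
rewrite ler_pdivlMr; last by nra.
rewrite mulrC ler_pdivrMr; nra.
Qed.

(** Three cases. If [l < 2 j], the last summand exceeds 1. If [j y <= 1], dropping [j + rj] starts
    costs at most the factor [expR 2]. Otherwise [1 / y < j], and half of the exponent [l y] already
    makes the exponential at most [2 / (l y) < 2 j / l]. *)
Lemma avoid_prob_gap_le j l rj rl : (4 <= rl)%N -> (0 < j <= l)%N -> (rj <= rl)%N ->
  f rl (l - j - rj) <=
  expR 2 * (2 * expR 6 * f rl l + 54 / l%:R) + 2 * expR 1 * j%:R / l%:R.
Proof.
move=> r4 /andP[j0 jl] rr.
have jR : 1 <= j%:R :> R by rewrite ler1n.
have lR : j%:R <= l%:R :> R by rewrite ler_nat.
have e1 : 2 <= expR 1 :> R by have := expR_ge1Dx (1 : R); lra.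
have e2 := expR_gt0 (2 : R); have e6 := expR_gt0 (6 : R).
have f0 := @avoid_prob_ge0 R rl l.
have A0 : 0 <= expR 2 * (2 * expR 6 * f rl l + 54 / l%:R).
  by rewrite mulr_ge0 ?(ltW e2)// addr_ge0// ?divr_ge0// !mulr_ge0// ltW.
have [l2j|l2j] := ltP (l%:R) (2 * j%:R : R).
  apply: le_trans (avoid_prob_le1 _ _) _; rewrite -[leLHS]add0r lerD//.
  by rewrite ler_pdivlMr; [nra|lra].
set y : R := 2^-1 ^+ rl.+1.
have y0 : 0 < y by exact: half_pow_gt0.
have ry : rj%:R * y <= 1.
  apply: le_trans (_ : rl.+2%:R * y <= _).
    by rewrite ler_pM2r// ler_nat; lia.
  by apply: le_trans (half_pow_mul_le r4) _; lra.
have fle : f rl (l - j - rj) <= expR (1 - (l%:R - j%:R) * y).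
  apply: le_trans (avoid_prob_le_expR _ _) _; rewrite -/y ler_expR.
  have : l%:R - j%:R - rj%:R <= (l - j - rj)%:R :> R.
    by rewrite lerBlDr lerBlDr -!natrD ler_nat; lia.
  by move=> /(ler_wpM2r (ltW y0)); rewrite mulrBl; lra.
have l0 : 0 < l%:R :> R by lra.
have [jy|jy] := leP (j%:R * y) 1.
  have B0 : 0 <= 2 * expR 1 * j%:R / l%:R :> R by rewrite divr_ge0// mulr_ge0//; lra.
  have : expR (1 - (l%:R - j%:R) * y) <= expR 2 * expR (- (l%:R * y)).
    by rewrite -expRD ler_expR mulrBl; lra.
  have : expR 2 * expR (- (l%:R * y)) <= expR 2 * (2 * expR 6 * f rl l + 54 / l%:R).
    by rewrite ler_pM2l//; apply: expR_le_avoid_prob => //; exact: leq_trans jl.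
  lra.
have : expR (1 - (l%:R - j%:R) * y) <= expR 1 * expR (- (l%:R * y / 2)).
  by rewrite -expRD ler_expR; nra.
have : expR 1 * expR (- (l%:R * y / 2)) <= 2 * expR 1 * j%:R / l%:R.
  rewrite -!mulrA [leRHS]mulrCA ler_pM2l ?expR_gt0// expRN mulrA.
  have : l%:R * y / 2 <= expR (l%:R * y / 2) by have := expR_ge1Dx (l%:R * y / 2); lra.
  rewrite -mulrA; set E := expR _ => HE; have E0 : 0 < E by exact: expR_gt0.
  by rewrite mulrA ler_pdivlMr// mulrC ler_pdivrMr//; nra.
lra.
Qed.

Lemma sum_sym_le (s : seq nat) (a : nat -> nat -> R) :
  (forall j l, 0 <= a j l) -> (forall j l, a j l = a l j) ->
  \sum_(j <- s) \sum_(l <- s) a j l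
  <= 2 * \sum_(j <- s) \sum_(l <- s | (j <= l)%N) a j l.
Proof.
move=> a0 asym; rewrite mulr_natl mulr2n.
rewrite (eq_bigr (fun j => \sum_(l <- s | (j <= l)%N) a j l +
   \sum_(l <- s | ~~ (j <= l)%N) a j l)); last by move=> j _; rewrite (bigID (fun l => (j <= l)%N)).
rewrite big_split /= lerD2l.
under eq_bigr do rewrite big_mkcond.
rewrite exchange_big /=; apply: ler_sum => j _; rewrite [leRHS]big_mkcond /=.
apply: ler_sum => l _; rewrite -ltnNge asym.
by case: ltnP => [/ltnW ->//|_]; case: ifP.
Qed.

Context (r : nat -> nat) (N M0 M1 : nat).
Hypothesis r_nd : forall m n, (M0 <= m)%N -> (m <= n)%N -> (r m <= r n)%N.
Hypothesis r4 : (4 <= r M0)%N.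
Hypothesis NM0 : (N < M0)%N.

(** Here [z] stands for a sequence stripped of its first [N] symbols, so only the starts
    [N, ..., n - 1] of the original are tested. *)
Let phi n (z : nat -> bool) : R := (avoid (r n) (n - N) z)%:R.
Let K := (M1 + r M1 + (M1 + r M1))%N.
Let x0 : nat -> bool := fun=> false.
Let e n := f (r n) (n - N).

(** The event for [j] reads only the first [p] symbols. Keeping, for [l], only the starts from [p]
    on makes the two events independent. *)
Lemma iter_transfer_avoid_pair j l : (M0 <= j <= l)%N -> (l < M1)%N ->
  iter K L (fun z => phi j z * phi l z) x0 <= e j * f (r l) (l - j - r j).
Proof.
move=> /andP[M0j jl] lM1; set p := (j - N + r j)%N.
have rjl : (r j <= r l)%N by apply: r_nd.
have rl1 : (r l <= r M1)%N by apply: r_nd; lia.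
pose psi v : R := (avoid (r l) (l - j - r j) v)%:R.
apply: le_trans (_ : iter (K - p + p) L (fun z => phi j z * psi (shiftn p z)) x0 <= _).
  rewrite subnK; last by rewrite /p /K; lia.
  apply: le_iter_transfer => z; rewrite /phi /psi; case: avoid; rewrite ?mul0r// !mul1r.
  rewrite ler_nat; have := @avoid_shiftn (r l) (l - N) p z.
  rewrite (_ : l - N - p = l - j - r j)%N; last by rewrite /p; lia.
  by case: (avoid (r l) (l - N) z) => // ->.
rewrite iter_transfer_independent; last first.
  exact/(determined_comp (fun b : bool => b%:R))/determined_avoid.
by rewrite avoid_prob_level// /K /p; lia.
Qed.

Lemma hit_prob_ge :
  1 <= \sum_(M0 <= n < M1) f (r n) n / n%:R ->
  (2 * moment_cst)^-1 <= iter K L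
    (fun z => (has (fun n => avoid (r n) (n - N) z) (index_iota M0 M1))%:R) x0.
Proof.
move=> sum1; set s := index_iota M0 M1 in sum1 *.
have sP n : n \in s -> (M0 <= n)%N /\ (n < M1)%N by rewrite mem_index_iota => /andP.
pose m := \sum_(n <- s) e n / n%:R.
have fm : \sum_(n <- s) f (r n) n / n%:R <= m.
  apply: ler_sum => n _; rewrite ler_wpM2r ?invr_ge0//.
  by apply: le_avoid_prob => //; exact: leq_subr.
have m1 : 1 <= m := le_trans sum1 fm.
pose S z := \sum_(n <- s) n%:R^-1 * phi n z.
have ES : iter K L S x0 = m.
  rewrite iter_transfer_sum; rewrite /m big_seq [RHS]big_seq; apply: eq_bigr => n /sP[M0n nM1].
  rewrite iter_transferZ avoid_prob_level 1?mulrC//.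
  have : (r n <= r M1)%N by apply: r_nd => //; exact: ltnW.
  by rewrite /K; lia.
have e0 n : 0 <= e n by exact: avoid_prob_ge0.
have M0_gt0 : (0 < M0)%N by exact: leq_ltn_trans NM0.
have inner j : j \in s ->
    \sum_(l <- s | (j <= l)%N) l%:R^-1 * f (r l) (l - j - r j) <= moment_cst * m.
  move=> /sP[M0j jM1].
  have j0 : (0 < j)%N := leq_trans M0_gt0 M0j.
  have jR : 0 < j%:R :> R by rewrite ltr0n.
  apply: le_trans (_ : \sum_(l <- s | (j <= l)%N) (2 * expR 8 * (f (r l) l / l%:R) +
     (54 * expR 2 + 2 * expR 1 * j%:R) * (l%:R ^+ 2)^-1) <= _).
    rewrite big_seq_cond [leRHS]big_seq_cond; apply: ler_sum => l /andP[/sP[M0l lM1] jl].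
    have l0 : 0 < l%:R :> R by rewrite ltr0n; exact: leq_trans jl.
    have r4l : (4 <= r l)%N by apply: leq_trans r4 _; exact: r_nd.
    have j0l : (0 < j <= l)%N by rewrite j0.
    have linv : 0 <= l%:R^-1 :> R by rewrite invr_ge0 ltW.
    apply: le_trans (ler_wpM2l linv (avoid_prob_gap_le r4l j0l (r_nd M0j jl))) _.
    rewrite (_ : expR 8 = expR 2 * expR 6); last by rewrite -expRD; congr expR; ring.
    by rewrite le_eqVlt; apply/orP; left; apply/eqP; field; rewrite gt_eqF.
  rewrite big_split /= -!mulr_sumr.
  have S1 : \sum_(l <- s | (j <= l)%N) f (r l) l / l%:R <= m.
    apply: le_trans fm; rewrite big_mkcond /=; apply: ler_sum => l _.
    by case: ifP => // _; rewrite divr_ge0// avoid_prob_ge0.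
  have S2 : \sum_(l <- s | (j <= l)%N) (l%:R ^+ 2)^-1 <= 2 / j%:R :> R.
    rewrite /s -big_filter.
    rewrite (_ : [seq l <- _ | _] = index_iota j M1); first exact: sum_inv_sqr.
    apply: (irr_sorted_eq ltn_trans ltnn).
    - by apply: sorted_filter; [exact: ltn_trans|exact: iota_ltn_sorted].
    - exact: iota_ltn_sorted.
    by move=> l; rewrite mem_filter !mem_index_iota; lia.
  have e81 := expR_gt0 (8 : R); have e21 := expR_gt0 (2 : R); have e11 := expR_gt0 (1 : R).
  apply: le_trans (_ : 2 * expR 8 * m + (54 * expR 2 + 2 * expR 1 * j%:R) * (2 / j%:R) <= _).
    have c1 : 0 <= 2 * expR 8 :> R by lra.
    have c2 : 0 <= 54 * expR 2 + 2 * expR 1 * j%:R :> R.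
      by rewrite addr_ge0// !mulr_ge0// ltW.
    exact: lerD (ler_wpM2l c1 S1) (ler_wpM2l c2 S2).
  (* Together with [m >= 1] this absorbs the summands free of [m] into [moment_cst * m]. *)
  have j1 : j%:R^-1 <= 1 :> R by rewrite invf_le1// ler1n.
  rewrite (_ : (54 * _ + _) * _ = 108 * expR 2 * j%:R^-1 + 4 * expR 1); last first.
    by field; rewrite gt_eqF.
  rewrite /moment_cst; nra.
have ES2 : iter K L (fun z => S z * S z) x0 <= 2 * (moment_cst * m ^+ 2).
  rewrite (_ : (fun z => _) = (fun z => \sum_(j <- s) \sum_(l <- s)
     j%:R^-1 * l%:R^-1 * (phi j z * phi l z))); last first.
    apply/funext => z; rewrite /S mulr_suml; apply: eq_bigr => j _.
    by rewrite mulr_sumr; apply: eq_bigr => l _; ring.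
  rewrite iter_transfer_sum; under eq_bigr do rewrite iter_transfer_sum.
  apply: le_trans (sum_sym_le _ _ _) _.
  - move=> j l; rewrite -(iter_transfer_cst K 0 x0); apply: le_iter_transfer => z.
    by rewrite !mulr_ge0 ?invr_ge0.
  - by move=> j l; congr (iter K L _ x0); apply/funext => z; ring.
  rewrite ler_pM2l// expr2 mulrA {2}/m mulr_sumr.
  rewrite big_seq [leRHS]big_seq; apply: ler_sum => j js.
  have [M0j jM1] := sP j js.
  apply: le_trans (_ : e j / j%:R * \sum_(l <- s | (j <= l)%N) l%:R^-1 * f (r l) (l - j - r j) <= _).
    rewrite mulr_sumr big_seq_cond [leRHS]big_seq_cond.
    apply: ler_sum => l /andP[/sP[M0l lM1] jl]; rewrite iter_transferZ.
    rewrite (_ : e j / _ * _ = j%:R^-1 * l%:R^-1 * (e j * f (r l) (l - j - r j))); last by ring.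
    by apply: ler_wpM2l; [rewrite mulr_ge0 ?invr_ge0|apply: iter_transfer_avoid_pair; rewrite ?M0j].
  by rewrite [leRHS]mulrC; apply: ler_wpM2l; [rewrite divr_ge0|exact: inner].
have c0 := moment_cst_gt0.
(* The maximiser of [2 t m - 2 c m^2 t^2] with [c] for [moment_cst]; the maximum is [1 / (2 c)]. *)
pose t := (2 * moment_cst * m)^-1.
have t0 : 0 < t by rewrite invr_gt0 !mulr_gt0//; lra.
(* 1 - (1 - t S)^2 <= 1_{S <> 0} *)
apply: le_trans (_ : iter K L (fun z => (2 * t) * S z + - (t ^+ 2) * (S z * S z)) x0 <= _); last first.
  apply: le_iter_transfer => z.
  case: (boolP (has _ _)) => [_|/hasPn no].
    by rewrite -[leRHS]/(1 : R); have := sqr_ge0 (1 - t * S z); nra.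
  rewrite /S big1_seq ?mulr0 ?addr0// => n /= ns.
  by rewrite /phi (negbTE (no n ns)) mulr0.
rewrite iter_transferD !iter_transferZ ES.
have tm : t * (moment_cst * m) = 2^-1 by rewrite /t; field; rewrite !gt_eqF//; lra.
have : t ^+ 2 * iter K L (fun z => S z * S z) x0 <= (2 * moment_cst)^-1.
  apply: le_trans (_ : t ^+ 2 * (2 * (moment_cst * m ^+ 2)) <= _).
    by rewrite ler_pM2l// exprn_gt0.
  rewrite (_ : _ * _ = (t * (moment_cst * m)) ^+ 2 * 2 / moment_cst); last first.
    by field; rewrite gt_eqF.
  by rewrite tm le_eqVlt; apply/orP; left; apply/eqP; field; rewrite gt_eqF.
have -> : 2 * t * m = moment_cst^-1 by rewrite /t; field; rewrite !gt_eqF//; lra.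
rewrite mulNr invfM; lra.
Qed.

End second_moment.

Lemma avoid_cat r a b (z : nat -> bool) :
  avoid r a z -> avoid r b (shiftn a z) -> avoid r (a + b) z.
Proof.
move=> /avoidP Ha /avoidP Hb; apply/avoidP => k kab.
have [ka|ak] := ltnP k a; first exact: Ha.
have [|i ir xi] := Hb (k - a)%N; first lia.
by exists i => //; move: xi; rewrite /shiftn addnA subnKC.
Qed.

(** * Partial sums and tails of nonnegative series *)

Section series.
Context {R : realType}.
Implicit Type t : nat -> R.

Lemma nneseries_fin_le t (A : R) : (forall n, 0 <= t n) ->
  (forall n, \sum_(1 <= k < n) t k <= A) ->
  (\sum_(1 <= k <oo) (t k)%:E <= A%:E)%E.
Proof.
move=> t0 tA; apply: lime_le.
  by apply: is_cvg_nneseries => n _ _; rewrite lee_fin.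
by apply: nearW => n; rewrite sumEFin lee_fin.
Qed.

Lemma nneseries_pinfty_partial t (A : R) : (forall n, 0 <= t n) ->
  (\sum_(1 <= k <oo) (t k)%:E = +oo)%E -> exists n, A <= \sum_(1 <= k < n) t k.
Proof.
move=> t0 toy; apply: contrapT => /forallNP H.
have : (\sum_(1 <= k <oo) (t k)%:E <= A%:E)%E.
  by apply: nneseries_fin_le => // n; apply: ltW; rewrite ltNge; apply/negP/H.
by rewrite toy.
Qed.

Lemma nneseries_tail_le t (eta : R) : (forall n, 0 <= t n) -> 0 < eta ->
  (\sum_(1 <= k <oo) (t k)%:E < +oo)%E ->
  exists2 M, (1 <= M)%N & forall m n, (M <= m)%N -> \sum_(m <= k < n) t k <= eta.
Proof.
move=> t0 eta0 tfin.
have part n : ((\sum_(1 <= k < n) t k)%:E <= \sum_(1 <= k <oo) (t k)%:E)%E.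
  by rewrite -sumEFin; apply: nneseries_lim_ge => k _ _; rewrite lee_fin.
have Sfin : (\sum_(1 <= k <oo) (t k)%:E)%E \is a fin_num.
  by rewrite ge0_fin_numE//; apply: nneseries_ge0 => k _ _; rewrite lee_fin.
set S := (\sum_(1 <= k <oo) (t k)%:E)%E in tfin part Sfin *.
have [M HM] : exists M, fine S - eta < \sum_(1 <= k < M) t k.
  apply: contrapT => /forallNP H.
  have : (S <= (fine S - eta)%:E)%E.
    by apply: nneseries_fin_le => // n; rewrite leNgt; apply/negP/H.
  by rewrite -{1}(fineK Sfin) lee_fin; lra.
exists M.+1 => // m n Mm; have [mn|nm] := leqP m n; last first.
  by rewrite big_geq ?(ltW eta0)// ltnW.
have : \sum_(1 <= k < n) t k <= fine S by rewrite -lee_fin fineK.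
have -> : \sum_(1 <= k < n) t k = \sum_(1 <= k < m) t k + \sum_(m <= k < n) t k.
  by apply: big_cat_nat => //; exact: leq_ltn_trans Mm.
have -> : \sum_(1 <= k < m) t k = \sum_(1 <= k < M.+1) t k + \sum_(M.+1 <= k < m) t k.
  exact: big_cat_nat.
have : 0 <= \sum_(M.+1 <= k < m) t k by exact: sumr_ge0.
have : \sum_(1 <= k < M) t k <= \sum_(1 <= k < M.+1) t k.
  have [->|M0] := posnP M; first by rewrite !big_geq.
  by rewrite big_nat_recr//= lerDl.
lra.
Qed.

End series.

(** * Divergence: shrinking covers of the sequences without late misses *)

Section divergence.
Context {R : realType} (r : nat -> nat).
Hypothesis r_nd : forall m n, (1 <= m)%N -> (m <= n)%N -> (r m <= r n)%N.
Hypothesis r_unbounded : forall K : nat, exists2 m, (1 <= m)%N & (K < r m)%N.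
Local Notation f := (@avoid_prob R).
Local Notation L := (@transfer R).

(** This is the union bound over the [m] starts, read off from the recursion. *)
Lemma avoid_prob_ge rr m : 1 - m%:R * 2^-1 ^+ rr <= f rr m.
Proof.
have x0 := @half_pow_gt0 R rr.
elim: m => [|[|m] IH].
- by rewrite mul0r subr0 avoid_prob0.
- by rewrite mul1r avoid_prob1.
rewrite avoid_prob_rec -natr1 exprS.
have := @avoid_prob_le1 R rr (m.+1 - rr); have := @avoid_prob_ge0 R rr (m.+1 - rr).
by nra.
Qed.

Lemma r_large m b : exists2 M0, (m < M0)%N & (b < r M0)%N.
Proof.
have [k k1 bk] := r_unbounded b.
exists (maxn k m.+1); first by rewrite leq_max ltnSn orbT.
by apply: leq_trans bk _; apply: r_nd => //; exact: leq_maxl.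
Qed.

Hypothesis diverges : forall A : R, exists n,
  A <= \sum_(1 <= m < n) expR (- (m%:R * 2^-1 ^+ (r m).+1)) / m%:R.

Lemma avoid_prob_diverges M0 : (0 < M0)%N -> (4 <= r M0)%N ->
  exists M1, 1 <= \sum_(M0 <= n < M1) f (r n) n / n%:R.
Proof.
move=> M00 r4.
pose u m : R := expR (- (m%:R * 2^-1 ^+ (r m).+1)) / m%:R.
have u0 m : 0 <= u m by rewrite divr_ge0// expR_ge0.
have c0 : 0 < 2 * expR 6 :> R by rewrite mulr_gt0// expR_gt0.
set c := 2 * expR 6 in c0.
(* The target pays for the terms before [M0], for the errors [54 / m^2] with total at most 108, and
   for the [c] that remains after division. *)
have [n Hn] := diverges (\sum_(1 <= m < M0) u m + 108 + c).
have {}Hn : \sum_(1 <= m < M0) u m + 108 + c <= \sum_(1 <= m < n) u m by [].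
exists n; have [M0n|nM0] := leqP M0 n; last first.
  have [n0|n0] := posnP n.
    have : 0 <= \sum_(1 <= m < M0) u m by exact: sumr_ge0.
    have : \sum_(1 <= m < n) u m = 0 by rewrite n0 big_geq.
    lra.
  have E : \sum_(1 <= m < M0) u m = \sum_(1 <= m < n) u m + \sum_(n <= m < M0) u m.
    by apply: big_cat_nat => //; exact: ltnW.
  have : 0 <= \sum_(n <= m < M0) u m by exact: sumr_ge0.
  by move: Hn; rewrite E; lra.
rewrite (@big_cat_nat _ _ _ M0 1 n)//= in Hn.
have {}Hn : 108 + c <= \sum_(M0 <= m < n) u m by lra.
have : \sum_(M0 <= m < n) u m <=
    \sum_(M0 <= m < n) (c * (f (r m) m / m%:R) + 54 * (m%:R ^+ 2)^-1).
  rewrite big_seq [leRHS]big_seq; apply: ler_sum => m; rewrite mem_index_iota => /andP[M0m _].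
  have m0 : (0 < m)%N by exact: leq_trans M0m.
  have mR : 0 < m%:R :> R by rewrite ltr0n.
  have r4m : (4 <= r m)%N by apply: leq_trans r4 _; exact: r_nd.
  have minv : 0 <= m%:R^-1 :> R by rewrite invr_ge0 ltW.
  apply: le_trans (ler_wpM2r minv (@expR_le_avoid_prob R _ _ r4m m0)) _.
  by rewrite le_eqVlt; apply/orP; left; apply/eqP; rewrite /c; field; rewrite gt_eqF.
rewrite big_split /= -!mulr_sumr.
have := @sum_inv_sqr R M0 n M00.
have : 2 / M0%:R <= 2 :> R by rewrite ler_pdivrMr ?ltr0n// ler_peMr// ler1n.
set s := \sum_(_ <= _ < _) _; set s' := \sum_(_ <= _ < _) f _ _ / _.
move=> h1 h2 h3; have : c <= c * s' by lra.
by rewrite ler_peMr//; nra.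
Qed.

Let kappa : R := (2 * moment_cst)^-1.
Let never M z := forall m, (M <= m)%N -> ~~ avoid (r m) m z.

(** A far window is chosen by [hit_prob_ge]; its event [A], read after the first [N] symbols, is
    independent of [C] and has mean at least [kappa]. The new cover requires [A] to fail, except
    when a long run starts among the first [N] positions, which has probability at most [delta]. *)
Lemma never_cover_step M N (C : (nat -> bool) -> bool) (delta : R) : 0 < delta ->
  determined N C -> (forall z, never M z -> C z) ->
  exists N' (C' : (nat -> bool) -> bool),
    [/\ determined N' C', forall z, never M z -> C' z &
      mean N' (fun z => (C' z)%:R)
      <= (1 - kappa) * mean N (fun z => (C z)%:R) + delta].
Proof.
move=> delta0 DC CM.
have [b Nb] : exists b, N%:R * 2^-1 ^+ b <= delta.
  exists (Num.truncn (N%:R / delta)).+1; set b := _.+1.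
  rewrite exprVn ler_pdivrMr ?exprn_gt0// -ler_pdivrMl// mulrC.
  apply: ltW; apply: lt_le_trans (truncnS_gt _) _.
  by rewrite -natrX ler_nat -/b ltnW// ltn_expl.
have [M0 + bM0] := r_large (maxn M N) (maxn 4 b).
rewrite gtn_max => /andP[MM0 NM0]; move: bM0; rewrite gtn_max => /andP[r4 bM0].
have M00 : (0 < M0)%N by exact: leq_ltn_trans NM0.
have [M1 sum1] := avoid_prob_diverges M00 (ltnW r4).
have r_nd0 m n : (M0 <= m)%N -> (m <= n)%N -> (r m <= r n)%N.
  by move=> M0m; apply: r_nd; exact: leq_trans M0m.
have Hhit := hit_prob_ge r_nd0 (ltnW r4) NM0 sum1.
set K := (_ + _)%N in Hhit.
pose A z := has (fun n => avoid (r n) (n - N) z) (index_iota M0 M1).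
have DA : determined K A.
  move=> x x' H; apply: eq_in_has => n; rewrite mem_index_iota => /andP[M0n nM1].
  apply: determined_avoid => i ilt; apply: H; apply: leq_trans ilt _.
  have := r_nd0 _ _ M0n (ltnW nM1).
  by rewrite /K; lia.
pose C' z := C z && (~~ A (shiftn N z) || ~~ avoid (r M0) N z).
pose N' := (K + N + r M0)%N.
exists N', C'; split.
- have D1 := determinedW (_ : (N <= N')%N) DC.
  have D2 := determinedW (_ : (N + K <= N')%N) (determined_shiftn (m := N) DA).
  have D3 := determinedW (_ : (N + r M0 <= N')%N) (@determined_avoid (r M0) N).
  move=> x x' H; rewrite /C'; congr (_ && (~~ _ || ~~ _)).
  + by apply: D1 => //; rewrite /N'; lia.
  + by apply: D2 => //; rewrite /N'; lia.
  + by apply: D3 => //; rewrite /N'; lia.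
- move=> z nz; rewrite /C' CM//=; case: (boolP (avoid (r M0) N z)) => [az|]; last by rewrite orbT.
  rewrite orbF; apply/hasPn => n; rewrite mem_index_iota => /andP[M0n _].
  (* A miss seen beyond [N], together with no run starting before [N], is a genuine miss at [n]. *)
  apply/negP => /(avoid_cat (avoidW (r_nd0 _ _ (leqnn _) M0n) (leqnn _) az)).
  rewrite subnKC; last by apply: ltnW; exact: leq_trans M0n.
  by apply/negP/nz/(leq_trans (ltnW MM0)).
pose x0 : nat -> bool := fun=> false.
have DC' : determined N (fun z => (C z)%:R : R) by exact: (determined_comp (fun b : bool => b%:R)).
have DA' : determined K (fun z => 1 - (A z)%:R : R) by exact: (determined_comp (fun b : bool => 1 - b%:R)).
rewrite /mean -/x0.
apply: le_trans (_ : iter N' L (fun z => (C z)%:R * (1 - (A (shiftn N z))%:R) +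
   (1 - (avoid (r M0) N z)%:R)) x0 <= _).
  apply: le_iter_transfer => z; rewrite /C'.
  by case: (C z); case: (A _); case: avoid; rewrite /= ?mulr1n ?mulr0n; lra.
rewrite iter_transferD iter_transferB iter_transfer_cst avoid_prob_level; last by rewrite /N'; lia.
apply: lerD; last first.
  have := avoid_prob_ge (r M0) N.
  have : 2^-1 ^+ r M0 <= 2^-1 ^+ b :> R by apply: ler_wiXn2l; [lra|lra|exact: ltnW].
  by move=> /(ler_wpM2l (ler0n R N)); lra.
rewrite (_ : N' = K + r M0 + N)%N; last by rewrite /N'; lia.
rewrite (@iter_transfer_independent _ N (K + r M0) (fun z => 1 - (A z)%:R))// mulrC.
apply: ler_wpM2r.
  by rewrite -(iter_transfer_cst N 0 x0); apply: le_iter_transfer => z.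
rewrite (iter_transfer_level _ DA') ?leq_addr// /mean iter_transferB iter_transfer_cst.
by rewrite lerD2l lerN2.
Qed.

(** Taking [delta = kappa / 2 * q ^+ k] in each step leaves the factor
    [1 - kappa + kappa / 2 = q]. *)
Lemma never_cover M : exists2 q : R, 0 <= q < 1 & forall k,
  exists N (C : (nat -> bool) -> bool),
    [/\ determined N C, forall z, never M z -> C z &
      mean N (fun z => (C z)%:R) <= q ^+ k].
Proof.
have c4 : 4 <= moment_cst :> R.
  rewrite /moment_cst; have := expR_ge1Dx (1 : R).
  by have := expR_gt0 (8 : R); have := expR_gt0 (2 : R); lra.
have k0 : 0 < kappa by rewrite invr_gt0; lra.
have k1 : kappa <= 1 by rewrite invf_le1; lra.
pose q := 1 - kappa / 2; have q0 : 0 < q by rewrite /q; lra.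
exists q; first by rewrite /q; lra.
elim=> [|k [N [C [DC CM mC]]]].
  by exists 0%N, (fun=> true); split=> //; rewrite expr0.
have [|N' [C' [DC' CM' mC']]] := @never_cover_step M N C (kappa / 2 * q ^+ k) _ DC CM.
  by rewrite !mulr_gt0// exprn_gt0.
exists N', C'; split=> //; apply: (le_trans mC').
rewrite exprS {2}/q; have : (1 - kappa) * mean N (fun z => (C z)%:R) <= (1 - kappa) * q ^+ k.
  by apply: ler_wpM2l => //; lra.
lra.
Qed.

End divergence.

(** * Convergence: a harmonic averaging bound for the union of misses *)

Section convergence.
Context {R : realType} (r : nat -> nat).
Hypothesis r_nd : forall m n, (1 <= m)%N -> (m <= n)%N -> (r m <= r n)%N.
Local Notation f := (@avoid_prob R).
Local Notation L := (@transfer R).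

Lemma sum_inv_ge q m : (0 < q)%N -> (0 < m)%N ->
  q.+1%:R^-1 <= \sum_(m <= n < (m + m %/ q).+1) n%:R^-1 :> R.
Proof.
move=> q0 m0; set b := (m %/ q)%N.
apply: le_trans (_ : \sum_(m <= n < (m + b).+1) (m + b)%:R^-1 <= _); last first.
  rewrite big_seq [leRHS]big_seq; apply: ler_sum => n; rewrite mem_index_iota => /andP[mn nb].
  by rewrite lef_pV2 ?posrE ?ltr0n ?ler_nat//; lia.
rewrite sumr_const_nat (_ : (_ - _ = b.+1)%N); last lia.
rewrite -[leRHS]mulr_natl ler_pdivlMr ?ltr0n//; last lia.
rewrite mulrC ler_pdivrMr ?ltr0n// -natrM ler_nat.
have := ltn_ceil m q0; rewrite -/b; nia.
Qed.

(* If [m] occurs in the union, then for every [n] in [m, m (1 + 1/q)] the event on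
   the right occurs, and the corresponding [1/n] add up to at least 1/(q+1). *)
Lemma union_avoid_prob_le q M M' k x : (0 < q)%N -> (0 < M)%N ->
  (M'.*2 + r M'.*2 <= k)%N ->
  iter k L (fun z => (has (fun m => avoid (r m) m z) (index_iota M M'))%:R) x
  <= q.+1%:R * \sum_(M <= n < M'.*2) f (r n) (n * q %/ q.+1) / n%:R.
Proof.
move=> q0 M0 kM.
have q1 : 0 < q.+1%:R :> R by rewrite ltr0n.
apply: le_trans (_ : iter k L (fun z => q.+1%:R *
   \sum_(M <= n < M'.*2) n%:R^-1 * (avoid (r n) (n * q %/ q.+1) z)%:R) x <= _).
  apply: le_iter_transfer => z; case: hasP => [[m]|_]; last first.
    by rewrite mulr_ge0// sumr_ge0// => n _; rewrite mulr_ge0 ?invr_ge0.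
  rewrite mem_index_iota => /andP[Mm mM'] am; rewrite -[leLHS]/(1 : R).
  have m0 : (0 < m)%N by exact: leq_trans Mm.
  have mq : (m %/ q <= m)%N by exact: leq_div.
  rewrite mulrC -ler_pdivrMr// mul1r; apply: le_trans (sum_inv_ge q0 m0) _.
  have mM2 : (m <= M'.*2)%N by rewrite -addnn; lia.
  (* Since [m %/ q <= m], the whole block of indices attached to [m] lies below [M'.*2], the upper
     end of the sum. *)
  have mqM2 : (m + m %/ q < M'.*2)%N.
    by rewrite -addnn -addSn leq_add// (leq_trans mq)// ltnW.
  rewrite (@big_cat_nat _ _ _ m M M'.*2)//=.
  rewrite (@big_cat_nat _ _ _ (m + m %/ q).+1 m M'.*2)//=; last by rewrite leqW// leq_addr.
  have nn i j : 0 <= \sum_(i <= n < j) n%:R^-1 * (avoid (r n) (n * q %/ q.+1) z)%:R :> R.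
    by apply: sumr_ge0 => n _; rewrite mulr_ge0 ?invr_ge0.
  apply: le_trans (_ : \sum_(m <= n < (m + m %/ q).+1) n%:R^-1 * (avoid (r n) (n * q %/ q.+1) z)%:R <= _); last first.
    by rewrite addrCA lerDl addr_ge0.
  rewrite big_seq [leRHS]big_seq; apply: ler_sum => n; rewrite mem_index_iota => /andP[mn nm].
  rewrite (_ : avoid _ _ z) ?mulr1//; apply: avoidW am; first exact: r_nd.
  have := leq_divM m q; set b := (m %/ q)%N in nm * => mb.
  by rewrite -ltnS ltn_divLR//; nia.
rewrite iter_transferZ iter_transfer_sum ler_pM2l// big_seq [leRHS]big_seq.
apply: ler_sum => n; rewrite mem_index_iota => /andP[Mn nM].
rewrite iter_transferZ avoid_prob_level 1?mulrC//.
have : (r n <= r M'.*2)%N by apply: r_nd; [exact: leq_trans Mn|exact: ltnW].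
have : (n * q %/ q.+1 <= n)%N by rewrite -ltnS ltn_divLR//; nia.
by move: kM; rewrite -addnn; lia.
Qed.

(** The floor costs at most [expR 1]. The rest of the [eps] is split in two halves: one pays for the
    shrinking factor [q / (q + 1)], the other for replacing [ln (1 - x)] by [- x / (1 - x)], since
    [1 - eps <= (1 - eps / 2)^2]. *)
Lemma avoid_prob_shrink_le q rr n (eps : R) : 0 < eps -> (1 <= rr)%N ->
  q.+1%:R^-1 <= eps / 2 -> 2^-1 ^+ rr <= eps / 2 ->
  f rr (n * q %/ q.+1) <=
  expR 1 * (1 - 2^-1 ^+ rr) `^ (n%:R * (1 - eps) / 2).
Proof.
move=> eps0 rr1 qe xe; set x := 2^-1 ^+ rr in xe *.
have x0 : 0 < x by exact: half_pow_gt0.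
have x1 : x <= 2^-1 by rewrite -[leRHS]expr1; apply: ler_wiXn2l => //; lra.
have n0 : 0 <= n%:R :> R by [].
have yE : 2^-1 ^+ rr.+1 = x / 2 by rewrite exprS mulrC.
have q10 : 0 < q.+1%:R :> R by rewrite ltr0n.
pose p : R := q%:R / q.+1%:R.
have pE : p = 1 - q.+1%:R^-1 by rewrite /p -natr1; field; rewrite natr1 gt_eqF.
have gp : n%:R * p - 1 <= (n * q %/ q.+1)%:R.
  rewrite /p mulrA lerBlDr ler_pdivrMr// -natrM natr1 -natrM ler_nat ltnW//.
  exact: ltn_ceil.
rewrite /powR gt_eqF; last lra.
apply: le_trans (avoid_prob_le_expR _ _) _; rewrite yE -expRD ler_expR.
have key : - (p * x) <= (1 - eps) * ln (1 - x).
  have [e1|e1] := leP 1 eps.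
    have : ln (1 - x) <= 0 by apply: ln_le0; lra.
    have : 0 <= p * x by rewrite mulr_ge0 ?divr_ge0// ltW.
    nra.
  have lnx : - (x / (1 - x)) <= ln (1 - x).
    rewrite lerNl -lnV ?posrE; last lra.
    rewrite [X in ln X](_ : _ = 1 + x / (1 - x)); last by field; lra.
    by apply: le_ln1Dx; apply: lt_le_trans (_ : 0 <= _); rewrite ?divr_ge0//; lra.
  apply: le_trans (_ : (1 - eps) * - (x / (1 - x)) <= _); last by apply: ler_wpM2l => //; lra.
  rewrite mulrN lerN2 mulrA ler_pdivrMr; last lra.
  rewrite pE; have : (1 - eps / 2) * (1 - eps / 2) <= (1 - q.+1%:R^-1) * (1 - x).
    by apply: ler_pM; rewrite ?lerD2l ?lerN2//; lra.
  move: qe; set qi := q.+1%:R^-1; nra.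
have : n%:R * - (p * x) <= n%:R * ((1 - eps) * ln (1 - x)) by exact: ler_wpM2l.
have : (n%:R * p - 1) * (x / 2) <= (n * q %/ q.+1)%:R * (x / 2).
  by apply: ler_wpM2r => //; lra.
lra.
Qed.

End convergence.

(** * The measure of the eventually always hitting set *)

Section hitting.
Context {R : realType} (mu : probability binseq R).
Hypothesis mu_half : is_bernoulli_half mu.
Variable r : nat -> nat.
Hypothesis r_pos : forall m, (1 <= m)%N -> (0 < r m)%N.
Hypothesis r_nd : forall m n, (1 <= m)%N -> (m <= n)%N -> (r m <= r n)%N.
Hypothesis r_unbounded : forall K : nat, exists2 m, (1 <= m)%N & (K < r m)%N.
Local Notation L := (@transfer R).

Let H := ea_hitting left_shift (fun m => zero_cylinder (r m)).
(** The shift by one reflects that the orbit segment begins with [T x]: the symbol at position 0 is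
    never read. *)
Let miss m : set binseq := [set x | avoid (r m) m (shiftn 1 x)].

Lemma iter_left_shift k (x : binseq) : iter k left_shift x = shiftn k x.
Proof.
elim: k => [//|k IH]; rewrite iterS IH.
by apply/funext => i; rewrite /left_shift /shiftn addnS.
Qed.

Lemma hitP m (x : binseq) :
  orbit_segment left_shift m x `&` zero_cylinder (r m) !=set0 <->
  ~ miss m x.
Proof.
split=> [[_ [[k /andP[k1 km] <-]] z0]|/negP/avoidPn[k km zk]].
  rewrite iter_left_shift in z0; apply/negP/avoidPn.
  exists k.-1; first by rewrite prednK.
  by rewrite zrun_shiftn add1n prednK//; apply/zrunP.
exists (iter k.+1 left_shift x); split; first by exists k.+1.
by rewrite iter_left_shift => i ir; move: zk; rewrite zrun_shiftn => /zrunP; exact.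
Qed.

Lemma ea_hittingE : H = \bigcup_M \bigcap_(m in [set m | (M <= m)%N]) ~` miss m.
Proof.
apply/seteqP; split=> x.
  by move=> [M _ HM]; exists M => // m /HM /hitP.
by move=> [M _ HM]; exists M => // m /HM /hitP.
Qed.

Lemma determined_miss m : determined (1 + (m + r m)) (fun x => avoid (r m) m (shiftn 1 x)).
Proof. exact/(@determined_shiftn _ 1)/determined_avoid. Qed.

Lemma measurable_miss m : measurable (miss m).
Proof. exact: (determined_measurable mu_half (@determined_miss m)). Qed.

Lemma measurable_never M :
  measurable (\bigcap_(m in [set m | (M <= m)%N]) ~` miss m).
Proof. by apply: bigcap_measurable; [exists M => /=|move=> m _; apply: measurableC; exact: measurable_miss]. Qed.

Lemma measurable_ea_hitting : measurable H.
Proof. by rewrite ea_hittingE; apply: bigcup_measurable => M _; exact: measurable_never. Qed.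

(** Shift invariance of [mu] on finitely determined events: one extra iteration of the transfer
    operator removes the shift. *)
Lemma measure_shifted n (A : (nat -> bool) -> bool) : determined n A ->
  mu [set x : binseq | A (shiftn 1 x)] = (mean n (fun x => (A x)%:R))%:E.
Proof.
move=> D; rewrite (determined_measure mu_half (determined_shiftn (m := 1) D)).
congr _%:E; rewrite /mean addnC iterD; congr (iter n L _ _).
by apply/funext => z; rewrite (iter_transfer_shiftn 1 (fun x => (A x)%:R)).
Qed.

Lemma measure_zero_cylinder n : mu (zero_cylinder n) = (2^-1 ^+ n)%:E.
Proof. exact: (mu_half n (fun=> false)). Qed.

(** The hitting set is a countable union of sets without misses from [M] on, and [never_cover]
    bounds each of them by [q ^+ k] for every [k]. *)
Lemma ea_hitting_measure0 :
  (forall A : R, exists n,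
    A <= \sum_(1 <= m < n) expR (- (m%:R * 2^-1 ^+ (r m).+1)) / m%:R) ->
  mu H = 0%E.
Proof.
move=> dv; rewrite ea_hittingE; apply/measure_negligible.
  by apply: bigcup_measurable => M _; exact: measurable_never.
apply: negligible_bigcup => M; apply/negligibleP; first exact: measurable_never.
have [q /andP[q0 q1] Hq] := never_cover r_nd r_unbounded dv M.
set Q := \bigcap_(m in _) _.
have Qk k : (mu Q <= (q ^+ k)%:E)%E.
  have [N [C [DC CM mC]]] := Hq k.
  apply: le_trans (_ : (mu [set x : binseq | C (shiftn 1 x)] <= _)%E); last first.
    by rewrite (measure_shifted DC) lee_fin.
  apply: le_measure; rewrite ?inE.
  - exact: measurable_never.
  - exact: (determined_measurable mu_half (determined_shiftn (m := 1) DC)).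
  - by move=> x Qx; apply: CM => m /Qx /negP.
apply/eqP; rewrite eq_le measure_ge0 andbT.
have cq : (q ^+ k)%:E @[k --> \oo] --> (0 : R)%:E.
  by apply: cvg_EFin; [exact: nearW|apply: cvg_expr; rewrite ger0_norm].
rewrite -[leRHS]/((0 : R)%:E) -(cvg_lim _ cq)//; apply: lime_ge; first by apply/cvg_ex; eexists; exact: cq.
exact: nearW.
Qed.

(** A point outside the hitting set misses some [m >= M]. The finite unions [V M'] of such misses
    are bounded uniformly in [M'] by a tail of the series, and continuity from below passes this to
    their union. *)
Lemma ea_hitting_measure1 (eps : R) : 0 < eps ->
  (\sum_(1 <= n <oo)
     ((1 - 2^-1 ^+ r n) `^ (n%:R * (1 - eps) / 2) / n%:R)%:E < +oo)%E ->
  mu H = 1%E.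
Proof.
move=> eps0 sumfin.
pose t n : R := (1 - 2^-1 ^+ r n) `^ (n%:R * (1 - eps) / 2) / n%:R.
have t0 n : 0 <= t n by rewrite divr_ge0// powR_ge0.
pose q := (Num.truncn (2 / eps)).+1.
have qe : q.+1%:R^-1 <= eps / 2.
  rewrite invf_ple ?posrE ?ltr0n ?divr_gt0// invf_div.
  apply: ltW; apply: lt_le_trans (truncnS_gt _) _.
  by rewrite ler_nat leqnSn.
have [b be] : exists b, 2^-1 ^+ b <= eps / 2.
  exists (Num.truncn (2 / eps)).+1; rewrite exprVn invf_ple ?posrE ?divr_gt0 ?exprn_gt0// invf_div.
  apply: ltW; apply: lt_le_trans (truncnS_gt _) _.
  by rewrite -natrX ler_nat ltnW// ltn_expl.
suff nH : mu (~` H) = 0%E.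
  rewrite -[X in mu X]setCK probability_setC ?nH ?sube0//.
  by apply: measurableC; exact: measurable_ea_hitting.
have q10 : 0 < q.+1%:R * expR 1 :> R by rewrite mulr_gt0 ?ltr0n// expR_gt0.
suff small (e : R) : 0 < e -> (mu (~` H) <= e%:E)%E.
  apply/eqP; rewrite eq_le measure_ge0 andbT.
  by apply/lee_addgt0Pr => e e0; rewrite add0e; exact: small.
(* The tail is made small enough to offset the factor [q + 1] of the averaging bound and the
   [expR 1] of the floor. *)
move=> e0; have eta0 : 0 < e / (q.+1%:R * expR 1) by rewrite divr_gt0.
have [M1 M11 tailM1] := nneseries_tail_le t0 eta0 sumfin.
have [M MM1 bM] := r_large r_nd r_unbounded M1 b.
have M0 : (0 < M)%N by exact: leq_ltn_trans MM1.
pose V M' := [set x : binseq | has (fun m => avoid (r m) m (shiftn 1 x)) (index_iota M M')].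
have DV M' : determined (M'.*2 + r M'.*2)
    (fun z => has (fun m => avoid (r m) m z) (index_iota M M')).
  move=> x x' Hx; apply: eq_in_has => n; rewrite mem_index_iota => /andP[Mn nM'].
  apply: determined_avoid => i ilt; apply: Hx; apply: leq_trans ilt _.
  have nM2 : (n <= M'.*2)%N by rewrite -addnn; lia.
  by apply: leq_add => //; apply: r_nd => //; exact: leq_trans Mn.
have mV M' : measurable (V M').
  exact: (determined_measurable mu_half (determined_shiftn (m := 1) (DV M'))).
have Ve M' : (mu (V M') <= e%:E)%E.
  rewrite /V (measure_shifted (DV M')) lee_fin /mean.
  apply: le_trans (union_avoid_prob_le r_nd _ (isT : (0 < q)%N) M0 (leqnn _)) _.
  rewrite -ler_pdivlMl ?ltr0n//.
  apply: le_trans (_ : expR 1 * \sum_(M <= n < M'.*2) t n <= _).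
    rewrite mulr_sumr big_seq [leRHS]big_seq; apply: ler_sum => n.
    rewrite mem_index_iota => /andP[Mn _].
    have n1 : (1 <= n)%N by exact: leq_trans Mn.
    rewrite /t mulrA ler_wpM2r ?invr_ge0//; apply: avoid_prob_shrink_le => //.
      exact: r_pos.
    apply: le_trans be; apply: ler_wiXn2l; [lra|lra|].
    by apply: leq_trans (ltnW bM) _; exact: r_nd.
  rewrite mulrC -ler_pdivlMr ?expR_gt0//; apply: le_trans (tailM1 M _ (ltnW MM1)) _.
  by rewrite le_eqVlt; apply/orP; left; apply/eqP; field; rewrite !gt_eqF ?ltr0n// expR_gt0.
have HV : ~` H `<=` \bigcup_M' V M'.
  move=> x nHx; apply: contrapT => nV; apply: nHx; rewrite ea_hittingE.
  exists M => // m Mm miss_m; apply: nV; exists m.+1 => //.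
  by apply/hasP; exists m => //; rewrite mem_index_iota Mm ltnSn.
have mVU : measurable (\bigcup_M' V M') by exact: bigcupT_measurable.
apply: le_trans (_ : (mu (\bigcup_M' V M') <= _)%E).
  by apply: le_measure; rewrite ?inE//; by apply: measurableC; exact: measurable_ea_hitting.
have cV : mu (V M') @[M' --> \oo] --> mu (\bigcup_M' V M').
  apply: nondecreasing_cvg_mu => // i j ij; apply/subsetPset => x /hasP[m].
  rewrite mem_index_iota => /andP[Mm mi] am; apply/hasP; exists m => //.
  by rewrite mem_index_iota Mm (leq_trans mi).
rewrite -(cvg_lim _ cV)//; apply: lime_le; first by apply/cvg_ex; eexists; exact: cV.
exact: nearW.
Qed.

End hitting.

Theorem theorem1p4 (R : realType) (mu : probability binseq R)
  (mu_bernoulli : is_bernoulli_half mu)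
  (r : nat -> nat)
  (r_pos : forall m, (1 <= m)%N -> (0 < r m)%N)
  (r_nondecreasing : forall m n, (1 <= m)%N -> (m <= n)%N -> (r m <= r n)%N)
  (r_unbounded : forall K : nat, exists2 m, (1 <= m)%N & (K < r m)%N) :
  let B := fun m : nat => zero_cylinder (r m) in
  let muB := fun m : nat => fine (mu (B m)) in
  (exists2 D : R, 2 < D &
     \forall m \near \oo, D * ln (ln m%:R) / m%:R <= muB m)
  \/ (exists2 tau : R, 1 < tau &
     \forall m \near \oo, muB m <= 1 / (ln m%:R `^ tau)) ->
  ((exists2 eps : R, 0 < eps &
      (\sum_(1 <= n <oo)
         ((1 - muB n) `^ (n%:R * (1 - eps) / 2) / n%:R)%:E < +oo)%E) ->
   mu (ea_hitting left_shift B) = 1%E)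
  /\
  ((\sum_(1 <= n <oo) ((1 - muB n) `^ (n%:R / 2) / n%:R)%:E = +oo)%E ->
   mu (ea_hitting left_shift B) = 0%E).
Proof.
move=> B muB _.
have muBE n : muB n = 2^-1 ^+ r n by rewrite /muB /B measure_zero_cylinder.
split=> [[eps eps0 sumfin]|sumy].
  apply: (ea_hitting_measure1 _ _ _ _ eps0) => //.
  by move: sumfin; under eq_fun do under eq_bigr do rewrite muBE.
apply: ea_hitting_measure0 => // A.
have [n An] := nneseries_pinfty_partial A (fun n => divr_ge0 (powR_ge0 _ _) (ler0n R n)) sumy.
exists n; apply: (le_trans An); rewrite big_seq [leRHS]big_seq; apply: ler_sum => m.
rewrite mem_index_iota => /andP[m1 _]; rewrite ler_wpM2r ?invr_ge0// muBE.
have x0 := @half_pow_gt0 R (r m).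
(* Positivity of [r m] keeps the base [1 - x] away from 0, where [powR] takes a default value. *)
have x1 : 2^-1 ^+ r m <= 2^-1 :> R.
  by rewrite -[leRHS]expr1; apply: ler_wiXn2l; [lra|lra|exact: r_pos].
rewrite /powR gt_eqF; last lra.
rewrite ler_expR exprS.
(* From [ln (1 - x) <= - x], the power with exponent [m / 2] is at most the exponential of
   [- m x / 2], and [x / 2] is the rate [2^-1 ^+ (r m).+1]. *)
have : ln (1 + - 2^-1 ^+ r m) <= - 2^-1 ^+ r m :> R by apply: le_ln1Dx; lra.
have : 0 <= m%:R :> R by [].
by nra.
Qed.
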